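(* Let $\varepsilon=MN^{-1}$, $c=N^{1/2}C$ and $\varrho(w)=N^{-1/2}\lambda(N^{-1/2}w)$ for $|w|\le c$. Let $\sigma$ be a strategy, processing the data in batches of size $M$, with $\sigma_\ell(s,x,t)$ ($\ell=1,2$) the probability of choosing the $\ell$-th action for the next batch given the scaled history $(s,x,t)$. Consider the dynamic programming equation $$l_\varepsilon(\sigma;s,x,t)=\sigma_1(s,x,t)\,l_{1,\varepsilon}(\sigma;s,x,t)+\sigma_2(s,x,t)\,l_{2,\varepsilon}(\sigma;s,x,t),$$ where $s,t$ are nonnegative multiples of $\varepsilon$ with $s+t\le1$, $l_{1,\varepsilon}(\sigma;s,x,t)=l_{2,\varepsilon}(\sigma;s,x,t)=0$ for $s+t=1$, and $$l_{1,\varepsilon}(\sigma;s,x,t)=\varepsilon g_1(x,t)+l_\varepsilon(\sigma;s+\varepsilon,x,t),$$ $$l_{2,\varepsilon}(\sigma;s,x,t)=\varepsilon g_2(x,t)+l_\varepsilon(\sigma;s,x,t+\varepsilon)*f_{\varepsilon D}(x)$$ for $0\le s+t<1$, with $$g_1(x,t)=\int_0^c w\exp\left(D^{-1}(xw-0.5\,tw^2)\right)\varrho(w)\,dw,$$ $$g_2(x,t)=\int_{-c}^0|w|\exp\left(D^{-1}(xw-0.5\,tw^2)\right)\varrho(w)\,dw.$$ Then the expected losses are $$L_N(\sigma;\lambda)=N^{1/2}\,l_\varepsilon(\sigma;0,0,0).$$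
   Context: Gaussian densities: for a variance $V>0$, $f_V(x|a)=(2\pi V)^{-1/2}\exp\{-(x-a)^2/(2V)\}$ and $f_V(x)=f_V(x|0)$. Convolution is taken in the $x$ variable: $F(x)*G(x)=\int_{-\infty}^{\infty}F(x-y)G(y)\,dy$. Gaussian one-armed bandit: fix $D>0$, $0<C<\infty$ and positive integers $N,M$ with $N$ a multiple of $M$. At each step $i=1,\dots,N$ an action $y_i\in\{1,2\}$ is chosen and a random income $\xi_i$ depending only on the current action is received. If $y_i=2$, $\xi_i$ has density $f_D(x|m)$ with $D$ known and $m$ unknown; if $y_i=1$, $\xi_i$ has a known distribution with expectation $0$. The parameter is $\theta=(0,m)$, with $|m|\le C$, i.e. $|w|\le c$ for $w=N^{1/2}m$. Strategies: the history is described by $(k,X,n)$, where $k,n$ are the numbers of past applications of the first and the second action and $X$ is the cumulative income from the second action ($X=0$ if $n=0$). A strategy $\sigma$ assigns to each history a (possibly randomized) selection of the next action; a selection is made when $k,n$ are multiples of $M$ and the selected action is used for the next $M$ steps. Scaled variables: $s=k/N$, $t=n/N$, $x=N^{-1/2}X$; $\sigma_\ell(s,x,t)$ is the probability of selecting action $\ell$ at the history $(k,X,n)$. Loss: $L_N(\sigma,\theta)=N\max(0,m)-\mathrm{E}_{\sigma,\theta}\bigl(\sum_{i=1}^N\xi_i\bigr)$. Prior: $\lambda$ is a probability density of $m$ on $[-C,C]$ with $\int_{-C}^0|m|\lambda(m)\,dm>0$ and $\int_0^C m\lambda(m)\,dm>0$. Expected losses averaged over the prior: $L_N(\sigma;\lambda)=\int_{-C}^{C}L_N(\sigma,(0,m))\,\lambda(m)\,dm$.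 *)

(* Defs.v *)
From HB Require Import structures.
From mathcomp Require Import all_boot all_order all_algebra.
From mathcomp Require Import all_classical all_reals all_analysis.
Set Implicit Arguments.
Unset Strict Implicit.
Unset Printing Implicit Defensive.
Import Order.TTheory GRing.Theory Num.Theory.
Import numFieldNormedType.Exports.
Local Open Scope classical_set_scope.
Local Open Scope ring_scope.

(* The two actions: [arm1] has a known income law with mean 0, [arm2] has
   Gaussian income with unknown mean. *)
Definition arm1 : bool := false.
Definition arm2 : bool := true.

(* f_V(x|a).  The parameter V is the variance, whereas the second parameter of
   the library's [normal_pdf] and [normal_prob] is the standard deviation. *)
Definition gauss_density (R : realType) (V a x : R) : R :=
  normal_pdf a (Num.sqrt V) x.

Definition convolution (R : realType) (F G : R -> R) (x : R) : R :=
  \int[lebesgue_measure]_(y in setT) (F (x - y) * G y).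

Record is_prior (R : realType) (C : R) (lambda : R -> R) : Prop := IsPrior {
  prior_measurable : measurable_fun `[- C, C] lambda;
  prior_ge0 : forall m, `|m| <= C -> 0 <= lambda m;
  prior_mass1 :
    (\int[lebesgue_measure]_(m in `[(- C)%R, C]) (lambda m)%:E = 1)%E;
  prior_neg :
    (0 < \int[lebesgue_measure]_(m in `[(- C)%R, 0%R]) (`|m| * lambda m)%:E)%E;
  prior_pos :
    (0 < \int[lebesgue_measure]_(m in `[0%R, C]) (m * lambda m)%:E)%E }.

Section strategy.
Context {R : realType}.
Variables (N M : nat).

Definition eps : R := M%:R / N%:R.

(* s and t are nonnegative multiples of eps *)
Definition on_grid (s t : R) : Prop :=
  exists a b : nat, s = a%:R * eps /\ t = b%:R * eps.

(* [sigma l s x t] is the probability of selecting action [l] at the scaled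
   history (s, x, t).  It matters only when a selection is still to be made,
   that is at grid points with s + t < 1. *)
Record is_strategy (sigma : bool -> R -> R -> R -> R) : Prop := IsStrategy {
  strategy_ge0 : forall l s x t, on_grid s t -> s + t < 1 ->
    0 <= sigma l s x t;
  strategy_sum1 : forall s x t, on_grid s t -> s + t < 1 ->
    sigma arm1 s x t + sigma arm2 s x t = 1;
  strategy_measurable : forall l s t, on_grid s t -> s + t < 1 ->
    measurable_fun setT (fun x => sigma l s x t) }.

End strategy.

Section bandit.
Context {R : realType} {d : measure_display} {Omega : measurableType d}.
Variables (N M : nat) (D : R) (nu1 : set R -> \bar R).
Variable sigma : bool -> R -> R -> R -> R.
(* Action chosen and income received at each step; steps are numbered from 0,
   so that only the indices i < N are relevant. *)
Variables (y : nat -> Omega -> bool) (xi : nat -> Omega -> R).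

(* Numbers of past applications of each action before step i, and cumulative
   income from the second action. *)
Definition applications (l : bool) (i : nat) (w : Omega) : nat :=
  (\sum_(j < i | y j w == l) 1)%N.
Definition income2 (i : nat) (w : Omega) : R :=
  \sum_(j < i | y j w == arm2) xi j w.

(* The sigma-algebra generated by (y_j, xi_j), j < i. *)
Definition past (i : nat) : set (set Omega) :=
  g_sigma_preimage (fun j : 'I_i => fun w => (y j w, xi j w)).

Definition income_law (m : R) (l : bool) : set R -> \bar R :=
  if l == arm2 then normal_prob m (Num.sqrt D) else nu1.

(* [P] is a law of the process (y_i, xi_i) under the strategy [sigma] and the
   parameter (0, m).  The conditional laws given the past are expressed by
   their defining identities over the events of the past; the last two fields
   say that
     P(y_i = l | past i) = sigma_l at the current scaled history,
     P(xi_i \in B | past i, y_i) = income_law m y_i B. *)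
Record bandit_law (P : probability Omega R) (m : R) : Prop := BanditLaw {
  law_action_measurable : forall i, (i < N)%N -> measurable_fun setT (y i);
  law_income_measurable : forall i, (i < N)%N -> measurable_fun setT (xi i);
  law_batch : forall i w, (i < N)%N -> ~~ (M %| i)%N -> y i w = y i.-1 w;
  law_action : forall i l E, (i < N)%N -> (M %| i)%N -> past i E ->
    P (E `&` y i @^-1` [set l]) =
    (\int[P]_(w in E) (sigma l ((applications arm1 i w)%:R / N%:R)
                               ((Num.sqrt N%:R)^-1 * income2 i w)
                               ((applications arm2 i w)%:R / N%:R))%:E)%E;
  law_income : forall i l E B, (i < N)%N -> past i E -> measurable B ->
    P (E `&` y i @^-1` [set l] `&` xi i @^-1` B) =
    (P (E `&` y i @^-1` [set l]) * income_law m l B)%E }.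

Definition total_income (w : Omega) : R := \sum_(i < N) xi i w.

Definition loss (P : probability Omega R) (m : R) : \bar R :=
  ((N%:R * Num.max 0 m)%:E - 'E_P[total_income])%E.

(* [P m] is the law of the process under the parameter (0, m). *)
Definition mean_loss (C : R) (lambda : R -> R) (P : R -> probability Omega R) :
    \bar R :=
  (\int[lebesgue_measure]_(m in `[(- C)%R, C]) (loss (P m) m * (lambda m)%:E))%E.

End bandit.

Section dynamic_programming.
Context {R : realType}.
Variables (N M : nat) (D C : R) (lambda : R -> R).

Let c : R := Num.sqrt N%:R * C.

Definition scaled_prior (w : R) : R :=
  (Num.sqrt N%:R)^-1 * lambda ((Num.sqrt N%:R)^-1 * w).

Definition g1 (x t : R) : R :=
  \int[lebesgue_measure]_(w in `[0, c])
    (w * expR (D^-1 * (x * w - 2^-1 * t * w ^+ 2)) * scaled_prior w).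

Definition g2 (x t : R) : R :=
  \int[lebesgue_measure]_(w in `[- c, 0])
    (`|w| * expR (D^-1 * (x * w - 2^-1 * t * w ^+ 2)) * scaled_prior w).

Local Notation e := (@eps R N M).

Record dp_equation (sigma : bool -> R -> R -> R -> R)
    (l l1 l2 : R -> R -> R -> R) : Prop := DPEquation {
  dp_mix : forall s x t, on_grid N M s t -> s + t <= 1 ->
    l s x t = sigma arm1 s x t * l1 s x t + sigma arm2 s x t * l2 s x t;
  dp_end : forall s x t, on_grid N M s t -> s + t = 1 ->
    l1 s x t = 0 /\ l2 s x t = 0;
  dp_step1 : forall s x t, on_grid N M s t -> s + t < 1 ->
    l1 s x t = e * g1 x t + l (s + e) x t;
  dp_step2 : forall s x t, on_grid N M s t -> s + t < 1 ->
    l2 s x t = e * g2 x t +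
      convolution (fun z => l s z (t + e)) (gauss_density (e * D) 0) x }.

End dynamic_programming.

(* Main.v *)
(* Condition on the parameter first.  For a fixed scaled mean [w], the loss still
   to come, [cond_loss], obeys a Bellman recursion in which a batch of the second
   action moves the scaled income by a Gaussian step of mean [eps * w] and
   variance [eps * D]; telescoping this recursion along the process gives
   L_N(sigma, (0, m)) = N^{1/2} cond_loss at w = N^{1/2} m.  Multiplying the
   Gaussian step by the likelihood exp((x w - t w^2 / 2) / D) removes its drift and
   updates (x, t) to (x + z, t + eps), so the average of [cond_loss] against
   likelihood times prior satisfies, by Tonelli, the recursion defining l_eps.  At
   the origin the likelihood is 1, which gives the claim. *)
Require Import Defs.
From HB Require Import structures.
From mathcomp Require Import all_boot all_order all_algebra.
From mathcomp Require Import all_classical all_reals all_analysis.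
From mathcomp Require Import measurable_realfun measurable_fun_approximation.
From mathcomp Require Import ring lra.
Set Implicit Arguments.
Unset Strict Implicit.
Unset Printing Implicit Defensive.
Import Order.TTheory GRing.Theory Num.Theory.
Import numFieldNormedType.Exports.
Local Open Scope classical_set_scope.
Local Open Scope ring_scope.

(** Two obstacles shape the proof. The conditional laws are given only as identities between
    probabilities of events, whereas the recursion concerns expectations. They are therefore
    transported to the pair formed by the number of batches of the second action and the scaled
    income: there the probability of an action becomes a density, and each new income becomes an
    independent factor. Incomes arrive one at a time while a selection lasts [M] steps, so the
    Gaussian step of a batch is assembled from [M] single ones by convolution.

    The other obstacle is finiteness. The conditional and averaged losses take values in the
    nonnegative extended reals, where Tonelli and linearity require only measurability; [g1], [g2]
    and [convolution] are real integrals, that is [fine] of extended ones. The two agree because the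
    conditional loss grows at most linearly in [|w|] and the prior has bounded support.

    The cost of a batch is its regret, proportional to [max 0 w] for the first action and to
    [max 0 (- w)] for the second. Measurability of the loss in [m] is read off from its closed
    form. *)

Local Notation pushforward_measure m mf :=
  (@measure_function_pushforward__canonical__measure_function_Measure
    _ _ _ _ _ m _ mf).

(** * Changes of measure *)

Section change_of_measure.
Local Open Scope ereal_scope.
Context d (T : measurableType d) (R : realType).
Variables (m m' : {measure set T -> \bar R}) (f : T -> R).
Hypothesis mf : measurable_fun setT f.
Hypothesis f0 : forall x, (0 <= f x)%R.
Hypothesis mE : forall B, measurable B -> m' B = \int[m]_(x in B) (f x)%:E.

Import HBNNSimple.

(** Simple functions and monotone convergence carry the identity [mE] from sets to nonnegative
    functions. Three densities occur below: the indicator of an event, the Gaussian density, and the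
    probability of an action as a function of the history. *)
Lemma ge0_integral_density (G : T -> \bar R) :
  measurable_fun setT G -> (forall x, 0 <= G x) ->
  \int[m']_x G x = \int[m]_x (G x * (f x)%:E).
Proof.
move=> mG G0; pose g_ := nnsfun_approx measurableT mG.
have gf n : measurable_fun setT (fun x => (g_ n x)%:E * (f x)%:E).
  by apply: emeasurable_funM; apply/measurable_EFinP => //; exact/measurable_funP.
have gG x : (g_ n x)%:E @[n --> \oo] --> G x.
  by apply: cvg_nnsfun_approx => // y _; exact: G0.
have ndg x : {homo g_^~ x : n k / (n <= k)%N >-> (n <= k)%R}.
  by move=> n k nk; exact/lefP/nd_nnsfun_approx.
transitivity (limn (fun n => \int[m']_x (g_ n x)%:E)).
  rewrite -monotone_convergence//.
  - by apply: eq_integral => x _; apply/esym/cvg_lim.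
  - by move=> n; exact/measurable_EFinP/measurable_funP.
  - by move=> n x _; rewrite lee_fin.
  - by move=> x _ n k nk; rewrite lee_fin; exact: ndg.
transitivity (limn (fun n => \int[m]_x ((g_ n x)%:E * (f x)%:E))); last first.
  rewrite -monotone_convergence//.
  - apply: eq_integral => x _; apply/cvg_lim => //.
    by apply: cvgeZr => //; exact: gG.
  - by move=> n x _; rewrite mule_ge0// lee_fin.
  - by move=> x _ n k nk; rewrite lee_wpmul2r ?lee_fin//; exact: ndg.
congr (limn _); apply/funext => n.
transitivity (\sum_(k \in range (g_ n)) \int[m']_x (k * \1_(g_ n @^-1` [set k]) x)%:E).
  under eq_integral do rewrite fimfunE -fsumEFin//.
  rewrite ge0_integral_fsum//.
  - by move=> ?; exact/measurable_EFinP/measurable_funM.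
  - by move=> ? ? _; rewrite nnfun_muleindic_ge0.
under [RHS]eq_integral => x _.
  rewrite fimfunE -fsumEFin// ge0_mule_fsuml; last first.
    by move=> ?; rewrite nnfun_muleindic_ge0.
  over.
rewrite ge0_integral_fsum//; last 2 first.
- by move=> ?; apply: emeasurable_funM; apply/measurable_EFinP => //;
    exact: measurable_funM.
- by move=> ? ? _; rewrite mule_ge0 ?lee_fin// -lee_fin EFinM nnfun_muleindic_ge0.
apply: eq_fsbigr => r _.
rewrite integralZl_indic_nnsfun// integral_indic// setIT.
have mgr : measurable (g_ n @^-1` [set r]) by [].
have [r0|r0] := leP 0%R r; last first.
  rewrite (_ : _ @^-1` _ = set0); last by rewrite preimage_nnfun0.
  by rewrite measure0 mule0 integral0_eq// => x _; rewrite indic0 mulr0 mul0e.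
under eq_integral do rewrite EFinM -muleA.
rewrite ge0_integralZl//; last 2 first.
  by apply: emeasurable_funM => //; exact/measurable_EFinP.
  by move=> x _; rewrite mule_ge0// lee_fin.
rewrite mE// [in LHS]integral_mkcond; congr (_ * _).
apply: eq_integral => x _; rewrite patchE indicE.
by case: ifPn => _; rewrite ?mul1e ?mul0e.
Qed.

End change_of_measure.

Lemma ge0_integral_mrestr d (T : measurableType d) (R : realType)
    (m : {measure set T -> \bar R}) (E : set T) (mE : measurable E)
    (G : T -> \bar R) :
  measurable_fun setT G -> (forall x, 0 <= G x)%E ->
  (\int[mrestr m mE]_x G x = \int[m]_(x in E) G x)%E.
Proof.
move=> mG G0.
rewrite (@ge0_integral_density _ _ _ m (mrestr m mE) \1_E)//.
- rewrite [RHS]integral_mkcond; apply: eq_integral => x _.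
  by rewrite patchE indicE; case: ifPn => _; rewrite ?mule1 ?mule0.
- by move=> B mB; rewrite integral_indic//= /mrestr setIC.
Qed.

(** The image under [(H, X)] of [P] restricted to [E] agrees with a product measure on rectangles,
    hence everywhere; Tonelli then freezes [H] while [X] is averaged under [Q]. The event [E] is
    separate from [H] so that it can be the choice of an action. *)
Lemma integral_independent d1 d2 d3 (T : measurableType d1)
    (T1 : measurableType d2) (T2 : measurableType d3) (R : realType)
    (P : {finite_measure set T -> \bar R}) (Q : probability T2 R) (E : set T)
    (H : T -> T1) (X : T -> T2) (v : T1 * T2 -> \bar R) :
  measurable E -> measurable_fun setT H -> measurable_fun setT X ->
  (forall A B, measurable A -> measurable B ->
    P (H @^-1` A `&` E `&` X @^-1` B) = (P (H @^-1` A `&` E) * Q B)%E) ->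
  measurable_fun setT v -> (forall z, 0 <= v z)%E ->
  (\int[P]_(w in E) v (H w, X w) = \int[P]_(w in E) \int[Q]_u v (H w, u))%E.
Proof.
move=> mE mH mX indep mv v0.
have mHX : measurable_fun setT (fun w => (H w, X w)) by exact: measurable_fun_pair.

pose r : {finite_measure set T -> \bar R} := mrestr P mE.
(* The image measure is repackaged as a finite one, because product measures and Tonelli call for
   sigma-finiteness. *)
have H1fin : fin_num_fun (pushforward r H).
  by move=> A mA; apply: fin_num_measure; rewrite -[_ @^-1` _]setTI; exact: mH.
pose H1 : {measure set T1 -> \bar R} :=
  pushforward_measure r mH.
pose m1 : {finite_measure set T1 -> \bar R} :=
  HB.pack (Measure.sort H1) (Measure_isFinite.Build _ _ _ H1 H1fin).
pose m12 : {measure set (T1 * T2) -> \bar R} :=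
  pushforward_measure r mHX.
have m12E A B : measurable A -> measurable B -> m12 (A `*` B) = (m1 A * Q B)%E.
  move=> mA mB; rewrite /m12 /m1/= /H1/= /pushforward /r /mrestr -indep//.
  by congr (P _); apply/seteqP; split => w /= [[? ?] ?].
have mF : measurable_fun setT (fun h => \int[Q]_u v (h, u))%E.
  exact: measurable_fun_fubini_tonelli_F.
have F0 h : (0 <= \int[Q]_u v (h, u))%E by exact: integral_ge0.
transitivity (\int[m12]_z v z)%E.
  rewrite ge0_integral_pushforward//= preimage_setT ge0_integral_mrestr//.
  exact: (measurableT_comp mv mHX).
rewrite (eq_measure_integral (m1 \x Q)%E); last first.
  by move=> A mA _; rewrite -(product_measure_unique m12E).
rewrite fubini_tonelli1// /fubini_F/=.
rewrite ge0_integral_pushforward//= preimage_setT ge0_integral_mrestr//.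
exact: (measurableT_comp mF mH).
Qed.

Lemma ge0_integral_oppr (R : realType) (G : R -> \bar R) :
  measurable_fun setT G -> (forall x, 0 <= G x)%E ->
  (\int[lebesgue_measure]_x G x = \int[lebesgue_measure]_x G (- x)%R)%E.
Proof.
move=> mG G0.
have mN : measurable_fun setT (-%R : R -> measurableTypeR R) by [].
transitivity (\int[pushforward lebesgue_measure
    (-%R : R -> measurableTypeR R)]_x G x)%E.
  apply: eq_measure_integral => A mA _; exact/esym/lebesgue_measureN.
by rewrite ge0_integral_pushforward//= preimage_setT.
Qed.

(** A positive factor preserves the orientation of half-open intervals, on which the rescaled image
    measure has the right length; uniqueness of Lebesgue measure does the rest. A reflection reduces
    a negative factor to a positive one. *)
Lemma ge0_integral_affine (R : realType) (a b : R) (G : R -> \bar R) :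
  a != 0 -> measurable_fun setT G -> (forall x, 0 <= G x)%E ->
  (\int[lebesgue_measure]_x G x =
   `|a|%:E * \int[lebesgue_measure]_x G (a * x + b)%R)%E.
Proof.
wlog a0 : a b G / 0 < a.
  move=> H a0 mG G0; have [|a0'|/eqP] := ltgtP a 0; last by rewrite (negbTE a0).
    move=> a1; rewrite (H (- a) b) ?oppr_gt0 ?oppr_eq0 ?normrN//; congr (_ * _)%E.
    rewrite (@ge0_integral_oppr _ (fun x => G (- a * x + b)))//.
      by apply: eq_integral => x _; rewrite mulrNN.
    by apply: measurableT_comp mG _; exact: measurable_funD.
  exact: H.
move=> _ mG G0.
pose f (x : R) : measurableTypeR R := a * x + b.
have mf : measurable_fun setT f by exact: measurable_funD.
pose m : {measure set (measurableTypeR R) -> \bar R} :=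
  pushforward_measure lebesgue_measure mf.
pose m' : {measure set (measurableTypeR R) -> \bar R} := mscale (NngNum (ltW a0)) m.
transitivity (\int[m']_x G x)%E.
  apply: eq_measure_integral => A mA _; apply: lebesgue_measure_unique => //.
  move=> _ [[p q]] _ <-.
  rewrite /m' /= /mscale /m/= /pushforward.
  rewrite (_ : f @^-1` _ = `](p - b) / a, (q - b) / a]%classic); last first.
    apply/seteqP; split => x /=; rewrite /f !in_itv/= ltr_pdivrMr// ler_pdivlMr//;
      by rewrite ltrBlDr lerBrDr (mulrC x).
  rewrite !lebesgue_measure_itv/= !lte_fin ltr_pM2r ?invr_gt0// ltrD2r.
  case: ifPn => _; last by rewrite mule0.
  by rewrite -!EFinB -EFinM; congr EFin; field; exact: lt0r_neq0.
rewrite /m' ge0_integral_mscale// ger0_norm ?ltW//=; congr (_ * _)%E.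
by rewrite /m ge0_integral_pushforward//= preimage_setT.
Qed.

(** * Gaussian laws *)

Section gauss_density.
Context {R : realType}.
Implicit Types (V a b k x y z w : R) (G : R -> \bar R).
Local Notation mu := (@lebesgue_measure R).

Lemma gauss_densityE V a x : 0 < V ->
  gauss_density V a x =
  (Num.sqrt (V * pi *+ 2))^-1 * expR (- (x - a) ^+ 2 / (V *+ 2)).
Proof.
move=> V0; have sV : Num.sqrt V != 0 by rewrite gt_eqF// sqrtr_gt0.
rewrite /gauss_density normal_pdfE// /normal_peak /normal_fun.
by rewrite sqr_sqrtr// ltW.
Qed.

Lemma gauss_density_ge0 V a x : 0 <= gauss_density V a x.
Proof. exact: normal_pdf_ge0. Qed.

Lemma measurable_gauss_density V : 0 < V ->
  measurable_fun setT (fun p : R * R => gauss_density V p.1 p.2).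
Proof.
move=> V0; under eq_fun do rewrite gauss_densityE//.
apply: measurable_funM => //; apply: measurableT_comp => //.
apply: measurable_funM => //; apply: measurableT_comp => //.
by apply: measurable_funX; apply: measurable_funB.
Qed.

Lemma measurable_gauss_density_fix V a : measurable_fun setT (gauss_density V a).
Proof. exact: measurable_normal_pdf. Qed.

Lemma emeasurable_gauss_density V a :
  measurable_fun setT (fun x => (gauss_density V a x)%:E).
Proof. by apply/measurable_EFinP; exact: measurable_gauss_density_fix. Qed.

Lemma integral_gauss_density V a : (\int[mu]_x (gauss_density V a x)%:E = 1)%E.
Proof. exact: integral_normal_pdf. Qed.

Lemma gauss_density_affine V a b k x : k != 0 -> 0 < V ->
  `|k| * gauss_density (k ^+ 2 * V) (k * a + b) (k * x + b) = gauss_density V a x.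
Proof.
move=> k0 V0; have k20 : 0 < k ^+ 2 by rewrite exprn_even_gt0.
rewrite (gauss_densityE _ _ V0) (gauss_densityE _ _ (mulr_gt0 k20 V0)).
rewrite -(mulrA (k ^+ 2)) -mulrnAr sqrtrM ?(ltW k20)// sqrtr_sqr invfM !mulrA.
rewrite divff ?normr_eq0// mul1r.
congr (_ * expR _); field.
by rewrite k0 gt_eqF.
Qed.

(* The Gaussian likelihood ratio turns the drift [e * w] into a reweighting. *)
Lemma gauss_density_tilt D e w x t z : 0 < D -> 0 < e ->
  gauss_density (e * D) (e * w) z * expR (D^-1 * (x * w - 2^-1 * t * w ^+ 2)) =
  gauss_density (e * D) 0 z *
    expR (D^-1 * ((x + z) * w - 2^-1 * (t + e) * w ^+ 2)).
Proof.
move=> D0 e0; rewrite !gauss_densityE ?mulr_gt0// -!mulrA -!expRD.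
congr (_ * expR _); field.
by rewrite (gt_eqF D0) gt_eqF.
Qed.

(** Completion of the square in [u]. The right-hand side is the density of the sum [z] of two
    independent Gaussians times the conditional density of the first summand given [z]. *)
Lemma gauss_density_mul V1 V2 a1 a2 u z : 0 < V1 -> 0 < V2 ->
  gauss_density V1 a1 u * gauss_density V2 a2 (z - u) =
  gauss_density (V1 + V2) (a1 + a2) z *
  gauss_density (V1 * V2 / (V1 + V2))
    ((a1 * V2 + (z - a2) * V1) / (V1 + V2)) u.
Proof.
move=> V10 V20; have V0 : 0 < V1 + V2 by rewrite addr_gt0.
rewrite !gauss_densityE ?divr_gt0 ?mulr_gt0//.
rewrite mulrACA [RHS]mulrACA -!invfM -!sqrtrM; last 2 first.
- by rewrite mulrn_wge0// mulr_ge0 ?pi_ge0// ltW.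
- by rewrite mulrn_wge0// mulr_ge0 ?pi_ge0// ltW.
rewrite -!expRD; congr ((Num.sqrt _)^-1 * expR _); field.
  by rewrite gt_eqF.
by rewrite !gt_eqF.
Qed.

Lemma ge0_integral_normal V a G : measurable_fun setT G ->
  (forall x, 0 <= G x)%E ->
  (\int[normal_prob a (Num.sqrt V)]_x G x =
   \int[mu]_x (G x * (gauss_density V a x)%:E))%E.
Proof.
move=> mG G0; apply: ge0_integral_density => //.
- exact: measurable_gauss_density_fix.
- by move=> x; exact: gauss_density_ge0.
Qed.

Lemma ge0_integral_gauss_affine V a b k G : k != 0 -> 0 < V ->
  measurable_fun setT G -> (forall x, 0 <= G x)%E ->
  (\int[mu]_x (G (k * x + b)%R * (gauss_density V a x)%:E) =
   \int[mu]_x (G x * (gauss_density (k ^+ 2 * V) (k * a + b) x)%:E))%E.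
Proof.
move=> k0 V0 mG G0.
have mGg : measurable_fun setT
    (fun x => G x * (gauss_density (k ^+ 2 * V) (k * a + b) x)%:E)%E.
  apply: emeasurable_funM => //.
    exact: emeasurable_gauss_density.
have Gg0 x : (0 <= G x * (gauss_density (k ^+ 2 * V) (k * a + b) x)%:E)%E.
  by rewrite mule_ge0// lee_fin gauss_density_ge0.
rewrite [RHS](ge0_integral_affine b k0)//.
rewrite -ge0_integralZl//; last first.
  by apply: (measurableT_comp mGg); exact: measurable_funD.
apply: eq_integral => x _.
by rewrite muleCA -EFinM gauss_density_affine.
Qed.

(** After the substitution [z = u + v] and Tonelli, [gauss_density_mul] isolates a Gaussian density
    in [u], which integrates to one. *)
Lemma ge0_integral_gauss_convolution V1 V2 a1 a2 G : 0 < V1 -> 0 < V2 ->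
  measurable_fun setT G -> (forall x, 0 <= G x)%E ->
  (\int[mu]_u (\int[mu]_v (G (u + v)%R * (gauss_density V2 a2 v)%:E) *
     (gauss_density V1 a1 u)%:E) =
   \int[mu]_z (G z * (gauss_density (V1 + V2) (a1 + a2) z)%:E))%E.
Proof.
move=> V10 V20 mG G0.
have g0 V a x : (0 <= (gauss_density V a x)%:E)%E by rewrite lee_fin gauss_density_ge0.
have mg := @emeasurable_gauss_density.
transitivity (\int[mu]_u \int[mu]_z
   (G z * (gauss_density V1 a1 u * gauss_density V2 a2 (z - u))%:E))%E.
  apply: eq_integral => u _.
  have mGu : measurable_fun setT (fun v => G (u + v)%R * (gauss_density V2 a2 v)%:E)%E.
    apply: emeasurable_funM => //.
    apply: (measurableT_comp mG); exact: measurable_funD.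
  rewrite -ge0_integralZr//; last by move=> x _; rewrite mule_ge0.
  rewrite [LHS](@ge0_integral_affine _ 1 (- u))//; last 2 first.
- exact: emeasurable_funM.
- by move=> x; rewrite !mule_ge0.
  rewrite normr1 mul1e; apply: eq_integral => z _.
  by rewrite mul1r addrC subrK -muleA -EFinM mulrC.
rewrite (fubini_tonelli (m1 := mu) (m2 := mu) (fun q : R * R => G q.2 *
  (gauss_density V1 a1 q.1 * gauss_density V2 a2 (q.2 - q.1))%:E)%E)/=; first last.
- by move=> [u z]/=; rewrite mule_ge0// lee_fin mulr_ge0// gauss_density_ge0.
- apply: emeasurable_funM; first exact: measurableT_comp mG _.
  apply/measurable_EFinP; apply: measurable_funM.
    exact: (measurableT_comp (measurable_gauss_density_fix _ _)).
  apply: (measurableT_comp (measurable_gauss_density_fix _ _)).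
  exact: measurable_funB.
apply: eq_integral => z _; rewrite /fubini_G/=.
under eq_integral do rewrite gauss_density_mul// EFinM muleA.
rewrite ge0_integralZl//; [|exact: mg|by rewrite mule_ge0].
by rewrite integral_gauss_density mule1.
Qed.

End gauss_density.

(** * Exponential moments and mean of the normal law *)

Section normal_mean.
Context {R : realType}.
Variables (V a : R).
Hypothesis V0 : 0 < V.
Local Notation N := (normal_prob a (Num.sqrt V)).
Local Notation mu := (@lebesgue_measure R).

(** Tilting by [expR (k * x)] shifts the mean to [a + k * V] and leaves a constant factor. The
    values [k = 1] and [k = -1] give integrability of the identity. *)
Lemma normal_expR (k : R) :
  (\int[N]_x (expR (k * x))%:E = (expR (k * a + k ^+ 2 * V / 2))%:E)%E.
Proof.
rewrite ge0_integral_normal//; last first.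
  by apply/measurable_EFinP; apply: measurableT_comp => //; exact: measurable_funM.
transitivity (\int[mu]_x ((expR (k * a + k ^+ 2 * V / 2))%:E *
    (gauss_density V (a + k * V) x)%:E))%E.
  apply: eq_integral => x _; rewrite -!EFinM !gauss_densityE// !(mulrCA (expR _)).
  rewrite -!expRD; congr (_ * expR _)%:E; field.
  by rewrite gt_eqF.
rewrite ge0_integralZl//; last 2 first.
- exact: emeasurable_gauss_density.
- by move=> x _; rewrite lee_fin gauss_density_ge0.
by rewrite integral_gauss_density mule1.
Qed.

Lemma normal_integrable : N.-integrable setT (fun x : R => x%:E).
Proof.
have mE k : measurable_fun setT (fun x : R => (expR (k * x))%:E).
  by apply/measurable_EFinP; apply: measurableT_comp => //; exact: measurable_funM.
apply/integrableP; split; first exact/measurable_EFinP.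
(* The majorant [|x| <= expR x + expR (- x)] comes from [1 + v <= expR v]. *)
apply: (@le_lt_trans _ _ (\int[N]_x ((expR (1 * x))%:E + (expR (-1 * x))%:E))%E).
  apply: ge0_le_integral => //.
  - by do 2 apply: measurableT_comp => //.
  - by apply: emeasurable_funD; apply: mE.
  move=> x _; rewrite /= -EFinD lee_fin mul1r mulN1r.
  have := expR_ge1Dx x; have := expR_ge1Dx (- x).
  have := expR_ge0 x; have := expR_ge0 (- x).
  by case: (leP 0 x) => x0; [rewrite ger0_norm|rewrite ltr0_norm] => //; lra.
rewrite ge0_integralD//; [|exact: mE|exact: mE].
by rewrite !normal_expR -EFinD ltry.
Qed.

(* The law is invariant under the reflection [x |-> 2 a - x]. *)
Lemma normal_mean : (\int[N]_x x%:E = a%:E)%E.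
Proof.
pose f (x : measurableTypeR R) : measurableTypeR R := -1 * x + 2 * a.
have mf : measurable_fun setT f by exact: measurable_funD.
have N10 : (-1 : R) != 0 by rewrite oppr_eq0 oner_eq0.
have fN A : measurable A -> pushforward N f A = N A.
  move=> mA.
  have mI : measurable_fun setT (fun x => (\1_A x)%:E : \bar R).
    exact/measurable_EFinP.
  have I0 (x : R) : (0 <= (\1_A x)%:E :> \bar R)%E by [].
  rewrite /pushforward -[f @^-1` A]setIT -integral_indic//; last first.
    by rewrite -[_ @^-1` _]setTI; exact: mf.
  rewrite -[in RHS](setIT A) -integral_indic//.
  rewrite [RHS]ge0_integral_normal//.
  rewrite (_ : (fun x : R => _) = (fun x => (\1_A (-1 * x + 2 * a))%:E)); last by [].
  rewrite ge0_integral_normal//; last first.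
    exact: measurableT_comp mI mf.
  rewrite [LHS](ge0_integral_gauss_affine a (2 * a) N10 V0 mI I0).
  have -> : (-1) ^+ 2 * V = V by ring.
  by have -> : -1 * a + 2 * a = a by ring.
have intN := normal_integrable.
have fE : (fun x => (f x)%:E) = (fun x => (2 * a)%:E - x%:E)%E.
  by apply/funext => x; rewrite -EFinB; congr EFin; rewrite /f; ring.
have intc : N.-integrable setT (fun=> (2 * a)%:E).
  exact: finite_measure_integrable_cst.
have intNf : N.-integrable setT (fun x => (f x)%:E).
  by rewrite fE; exact: integrableB.
have : (\int[N]_x x%:E = \int[N]_x (f x)%:E)%E.
  transitivity (\int[pushforward_measure N mf]_x x%:E)%E.
    by apply: eq_measure_integral => A mA _; exact/esym/fN.
  by rewrite integral_pushforward//= preimage_setT.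
rewrite (_ : \int[N]_x (f x)%:E = (2 * a)%:E - \int[N]_x x%:E)%E; last first.
  rewrite -[X in (X - _)%E]mule1 -(@probability_setT _ _ _ N) -integral_cst//.
  by rewrite -integralB// fE.
(* The mean equals [2 * a] minus itself; being finite, it can be solved for. *)
have := integrable_fin_num measurableT intN.
case: (\int[N]_x x%:E)%E => // r _ [] ra; congr EFin; lra.
Qed.

End normal_mean.

(** * Conditional losses and their averages over the prior *)

Section conditional_loss.
Context {R : realType}.
Variables (e D : R) (p : bool -> nat -> nat -> R -> R).
Hypotheses (e0 : 0 < e) (D0 : 0 < D).
Hypothesis p_ge0 : forall l a b x, 0 <= p l a b x.
Hypothesis p_sum1 : forall a b x, p arm1 a b x + p arm2 a b x = 1.
Hypothesis mp : forall l a b, measurable_fun setT (p l a b).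
Local Notation mu := (@lebesgue_measure R).

Lemma gauss_step_le V m (h : R -> \bar R) (B : R) x : 0 <= B ->
  measurable_fun setT h -> (forall y, 0 <= h y)%E -> (forall y, h y <= B%:E)%E ->
  (\int[mu]_z (h (x + z)%R * (gauss_density V m z)%:E) <= B%:E)%E.
Proof.
move=> B0 mh h0 hB.
apply: (@le_trans _ _ (\int[mu]_z (B%:E * (gauss_density V m z)%:E))%E).
  apply: ge0_le_integral => //.
  - by move=> z _; rewrite mule_ge0// lee_fin gauss_density_ge0.
  - apply: emeasurable_funM; last exact: emeasurable_gauss_density.
    by apply: (measurableT_comp mh); exact: measurable_funD.
  - by apply: emeasurable_funM => //; exact: emeasurable_gauss_density.
  - by move=> z _; rewrite lee_wpmul2r// lee_fin gauss_density_ge0.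
rewrite ge0_integralZl//; last 2 first.
- exact: emeasurable_gauss_density.
- by move=> z _; rewrite lee_fin gauss_density_ge0.
by rewrite integral_gauss_density mule1.
Qed.

(* Expected scaled loss over the last [r] batches, given the scaled mean [w],
   after [a] and [b] batches with the two actions and scaled income [x]. *)
Fixpoint cond_loss (r a b : nat) (w x : R) : \bar R :=
  if r is r'.+1 then
    ((p arm1 a b x)%:E * ((e * Num.max 0 w)%:E + cond_loss r' a.+1 b w x) +
     (p arm2 a b x)%:E * ((e * Num.max 0 (- w))%:E +
       \int[mu]_z (cond_loss r' a b.+1 w (x + z)%R *
                   (gauss_density (e * D) (e * w) z)%:E)))%E
  else 0%E.

Lemma cond_loss_ge0 r a b w x : (0 <= cond_loss r a b w x)%E.
Proof.
elim: r a b x => [|r IH] a b x //=.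
apply: adde_ge0; apply: mule_ge0; rewrite ?lee_fin//; apply: adde_ge0 => //.
- by rewrite lee_fin mulr_ge0 ?(ltW e0)// le_max lexx.
- by rewrite lee_fin mulr_ge0 ?(ltW e0)// le_max lexx.
by apply: integral_ge0 => z _; rewrite mule_ge0// lee_fin gauss_density_ge0.
Qed.

Lemma measurable_gauss_step (h : R -> R -> \bar R) :
  measurable_fun setT (fun q : R * R => h q.1 q.2) ->
  (forall w x, 0 <= h w x)%E ->
  measurable_fun setT (fun q : R * R => \int[mu]_z (h q.1 (q.2 + z)%R *
    (gauss_density (e * D) (e * q.1) z)%:E))%E.
Proof.
move=> mh h0.
apply: (measurable_fun_fubini_tonelli_F (m2 := mu) (fun s : (R * R) * R =>
  h s.1.1 (s.1.2 + s.2)%R *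
  (gauss_density (e * D) (e * s.1.1) s.2)%:E)%E).
  apply: emeasurable_funM.
    apply: (measurableT_comp mh
      (g := fun s : (R * R) * R => (s.1.1, s.1.2 + s.2))).
    apply: measurable_fun_pair; last apply: measurable_funD => //.
      exact: measurableT_comp.
    exact: measurableT_comp.
  apply/measurable_EFinP.
  apply: (measurableT_comp (measurable_gauss_density (mulr_gt0 e0 D0))
     (g := fun s : (R * R) * R => (e * s.1.1, s.2))).
  apply: measurable_fun_pair => //; apply: measurable_funM => //.
  exact: measurableT_comp.
by move=> s; rewrite mule_ge0 // lee_fin gauss_density_ge0.
Qed.

(** Joint measurability in the mean and the income is what Tonelli requires when the prior average
    is exchanged with the Gaussian step. *)
Lemma measurable_cond_loss r a b :
  measurable_fun setT (fun q : R * R => cond_loss r a b q.1 q.2).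
Proof.
elim: r a b => [|r IH] a b /=; first exact: measurable_cst.
apply: emeasurable_funD; apply: emeasurable_funM.
- by apply/measurable_EFinP; exact: (measurableT_comp (mp _ _ _)).
- apply: emeasurable_funD => //; apply/measurable_EFinP.
  by apply: measurable_funM => //; exact: measurable_maxr.
- by apply/measurable_EFinP; exact: (measurableT_comp (mp _ _ _)).
apply: emeasurable_funD; first apply/measurable_EFinP.
  apply: measurable_funM => //; apply: measurable_maxr => //.
  exact: measurableT_comp.
exact: (measurable_gauss_step (IH a b.+1) (cond_loss_ge0 r a b.+1)).
Qed.

Lemma measurable_cond_loss_mean r a b x :
  measurable_fun setT (fun w => cond_loss r a b w x).
Proof.
apply: (measurableT_comp (measurable_cond_loss r a b) (g := fun w => (w, x))).
exact: measurable_fun_pair.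
Qed.

Lemma measurable_cond_loss_income r a b w : measurable_fun setT (cond_loss r a b w).
Proof.
apply: (measurableT_comp (measurable_cond_loss r a b) (g := fun x => (w, x))).
exact: measurable_fun_pair.
Qed.

(** Each batch costs at most [e * |w|] whichever action is taken, and the action probabilities sum
    to one. *)
Lemma cond_loss_le r a b w x :
  (cond_loss r a b w x <= (r%:R * (e * `|w|))%:E)%E.
Proof.
elim: r a b x => [|r IH] a b x /=; first by rewrite mul0r.
have ew : 0 <= e * `|w| by rewrite mulr_ge0 ?(ltW e0).
have max_le (v : R) : Num.max 0 v <= `|v| by rewrite ge_max normr_ge0 ler_norm.
have step (u v : R) (h : \bar R) : v <= `|w| ->
    (h <= (r%:R * (e * `|w|))%:E)%E ->
    ((e * v)%:E + h <= (r.+1%:R * (e * `|w|))%:E)%E.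
  move=> vw hr; rewrite -natr1 mulrDl mul1r addrC EFinD leeD//.
  by rewrite lee_fin ler_pM2l.
apply: (@le_trans _ _ ((p arm1 a b x)%:E * (r.+1%:R * (e * `|w|))%:E +
    (p arm2 a b x)%:E * (r.+1%:R * (e * `|w|))%:E)%E); last first.
  by rewrite -!EFinM -EFinD -mulrDl p_sum1 mul1r.
apply: leeD; apply: lee_wpmul2l; rewrite ?lee_fin//; apply: step => //.
  by rewrite -(normrN w).
apply: gauss_step_le; first exact: mulr_ge0.
- exact: measurable_cond_loss_income.
- by move=> y; exact: cond_loss_ge0.
- by move=> y; exact: IH.
Qed.

(** * Averages weighted by likelihood and prior *)

Variables (c : R) (rho : R -> R).
Hypotheses (rho_ge0 : forall w, 0 <= rho w) (mrho : measurable_fun setT rho).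
Hypothesis rho_support : forall w, c < `|w| -> rho w = 0.
Hypothesis rho_finite : (\int[mu]_w (rho w)%:E < +oo)%E.

(** The unnormalised posterior density: the likelihood ratio of scaled mean [w] against mean [0],
    times the prior. *)
Definition posterior_weight (x t w : R) : R :=
  expR (D^-1 * (x * w - 2^-1 * t * w ^+ 2)) * rho w.

Lemma posterior_weight_ge0 x t w : 0 <= posterior_weight x t w.
Proof. by rewrite mulr_ge0 ?expR_ge0. Qed.

Lemma measurable_posterior_weight t :
  measurable_fun setT (fun q : R * R => posterior_weight q.1 t q.2).
Proof.
apply: measurable_funM; last exact: measurableT_comp.
apply: measurableT_comp => //; apply: measurable_funM => //.
apply: measurable_funB; first exact: measurable_funM.
by apply: measurable_funM => //; apply: measurable_funX.
Qed.

Lemma measurable_posterior_weight_mean x t : measurable_fun setT (posterior_weight x t).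
Proof.
apply: (measurableT_comp (measurable_posterior_weight t) (g := fun w => (x, w))).
exact: measurable_fun_pair.
Qed.

Lemma posterior_weight_tilt x t z w :
  gauss_density (e * D) (e * w) z * posterior_weight x t w =
  gauss_density (e * D) 0 z * posterior_weight (x + z) (t + e) w.
Proof.
rewrite /posterior_weight mulrA (gauss_density_tilt w x t z D0 e0).
by rewrite -mulrA.
Qed.

Definition bayes_loss r a b (x t : R) : \bar R :=
  (\int[mu]_w (cond_loss r a b w x * (posterior_weight x t w)%:E))%E.

Lemma bayes_loss_ge0 r a b x t : (0 <= bayes_loss r a b x t)%E.
Proof.
by apply: integral_ge0 => w _; rewrite mule_ge0 ?cond_loss_ge0// lee_fin
  posterior_weight_ge0.
Qed.

(** For [t >= 0] the quadratic term only lowers the exponent, so on [|w| <= c] the likelihood is at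
    most [expR (D^-1 * (|x| * c))], and [rho] has finite mass. *)
Lemma posterior_moment_lty x t (g : R -> \bar R) (k : R) : 0 <= t -> 0 <= k ->
  measurable_fun setT g -> (forall w, 0 <= g w)%E ->
  (forall w, g w <= (k * `|w|)%:E)%E ->
  (\int[mu]_w (g w * (posterior_weight x t w)%:E) < +oo)%E.
Proof.
move=> t0 k0 mg g0 gk.
pose K := `|k| * c * expR (D^-1 * (`|x| * c)).
have mW : measurable_fun setT (fun w => (posterior_weight x t w)%:E).
  by apply/measurable_EFinP; exact: measurable_posterior_weight_mean.
have mr : measurable_fun setT (fun w => (rho w)%:E) by exact/measurable_EFinP.
(* The sign of [c] is unknown here, hence [|K|]; for negative [c] the function [rho] vanishes
   identically. *)
apply: (@le_lt_trans _ _ (\int[mu]_w (`|K|%:E * (rho w)%:E))%E).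
  apply: ge0_le_integral => //.
  - by move=> w _; rewrite mule_ge0// lee_fin posterior_weight_ge0.
  - exact: emeasurable_funM.
  - exact: emeasurable_funM.
  move=> w _; have [cw|wc] := ltP c `|w|.
    by rewrite /posterior_weight rho_support// mulr0 !mule0.
  rewrite /posterior_weight EFinM muleA lee_wpmul2r ?lee_fin//.
  apply: (@le_trans _ _ ((k * `|w|)%:E *
      (expR (D^-1 * (x * w - 2^-1 * t * w ^+ 2)))%:E)%E).
    by rewrite lee_wpmul2r// lee_fin expR_ge0.
  rewrite -EFinM lee_fin (le_trans _ (ler_norm K))//.
  have c0 : 0 <= c by exact: le_trans wc.
  rewrite ler_pM ?expR_ge0 ?mulr_ge0//.
    by rewrite ler_pM// ler_norm.
  rewrite ler_expR ler_wpM2l ?invr_ge0 ?(ltW D0)//.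
  apply: (@le_trans _ _ (x * w)).
    by rewrite lerBlDr lerDl; apply: mulr_ge0; [exact: mulr_ge0|exact: sqr_ge0].
  by rewrite (le_trans (ler_norm _))// normrM ler_wpM2l.
rewrite ge0_integralZl//; last first.
  by move=> w _; rewrite lee_fin.
by rewrite lte_mul_pinfty// lee_fin.
Qed.

Lemma measurable_bayes_loss r a b t : measurable_fun setT (bayes_loss r a b ^~ t).
Proof.
apply: (measurable_fun_fubini_tonelli_F (m2 := mu) (fun q : R * R =>
  cond_loss r a b q.2 q.1 * (posterior_weight q.1 t q.2)%:E)%E).
  apply: emeasurable_funM; last first.
    by apply/measurable_EFinP; exact: measurable_posterior_weight.
  apply: (measurableT_comp (measurable_cond_loss r a b) (g := fun q => (q.2, q.1))).
  exact: measurable_fun_pair.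
by move=> q; rewrite mule_ge0 ?cond_loss_ge0// lee_fin posterior_weight_ge0.
Qed.

Lemma measurable_cond_loss_step r a b x : measurable_fun setT (fun w => \int[mu]_z
  (cond_loss r a b w (x + z)%R * (gauss_density (e * D) (e * w) z)%:E))%E.
Proof.
apply: (measurableT_comp (measurable_gauss_step (measurable_cond_loss r a b)
  (cond_loss_ge0 r a b)) (g := fun w => (w, x))).
exact: measurable_fun_pair.
Qed.

Lemma bayes_loss_convolution r a b x t :
  (\int[mu]_w (\int[mu]_z (cond_loss r a b w (x + z)%R *
      (gauss_density (e * D) (e * w) z)%:E) * (posterior_weight x t w)%:E) =
   \int[mu]_y (bayes_loss r a b (x - y)%R (t + e) *
                (gauss_density (e * D) 0 y)%:E))%E.
Proof.
transitivity (\int[mu]_w \int[mu]_z (cond_loss r a b w (x + z)%R *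
    (gauss_density (e * D) 0 z * posterior_weight (x + z) (t + e) w)%:E))%E.
  apply: eq_integral => w _; rewrite -ge0_integralZr//; last 3 first.
  - apply: emeasurable_funM; last exact: emeasurable_gauss_density.
    apply: (measurableT_comp (measurable_cond_loss_income _ _ _ _)).
    exact: measurable_funD.
  - by move=> z _; rewrite mule_ge0 ?cond_loss_ge0// lee_fin gauss_density_ge0.
  - by rewrite lee_fin posterior_weight_ge0.
  by apply: eq_integral => z _; rewrite -muleA -EFinM posterior_weight_tilt.
rewrite (fubini_tonelli (m1 := mu) (m2 := mu) (fun q : R * R =>
    cond_loss r a b q.1 (x + q.2)%R *
    (gauss_density (e * D) 0 q.2 * posterior_weight (x + q.2) (t + e) q.1)%:E)%E)/=;
  first last.
- by move=> q; rewrite mule_ge0 ?cond_loss_ge0// lee_fin mulr_ge0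
    ?gauss_density_ge0 ?posterior_weight_ge0.
- apply: emeasurable_funM.
    apply: (measurableT_comp (measurable_cond_loss r a b)
      (g := fun q => (q.1, x + q.2))).
    by apply: measurable_fun_pair => //; exact: measurable_funD.
  apply/measurable_EFinP; apply: measurable_funM.
    exact: (measurableT_comp (measurable_gauss_density_fix _ _)).
  apply: (measurableT_comp (measurable_posterior_weight (t + e))
    (g := fun q => (x + q.2, q.1))).
  by apply: measurable_fun_pair => //; exact: measurable_funD.
(* The convolution evaluates at [x - y] while the income moves to [x + z]; reflection and evenness
   of the centred density reconcile them. *)
rewrite [RHS]ge0_integral_oppr; last 2 first.
- apply: emeasurable_funM; last exact: emeasurable_gauss_density.
  apply: (measurableT_comp (measurable_bayes_loss _ _ _ _)).
  exact: measurable_funB.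
- by move=> y; rewrite mule_ge0 ?bayes_loss_ge0// lee_fin gauss_density_ge0.
apply: eq_integral => z _; rewrite /fubini_G/= opprK.
have -> : gauss_density (e * D) 0 (- z) = gauss_density (e * D) 0 z.
  by rewrite !gauss_densityE ?mulr_gt0// !subr0 sqrrN.
rewrite /bayes_loss -ge0_integralZr//; last 3 first.
- apply: emeasurable_funM; first exact: measurable_cond_loss_mean.
  by apply/measurable_EFinP; exact: measurable_posterior_weight_mean.
- by move=> w _; rewrite mule_ge0 ?cond_loss_ge0// lee_fin posterior_weight_ge0.
- by rewrite lee_fin gauss_density_ge0.
by apply: eq_integral => w _; rewrite -muleA -EFinM [in RHS]mulrC.
Qed.

(** Finiteness is checked on the side with drift: there the Gaussian step inherits the bound of
    [cond_loss], so a moment of the weight at the single point [(x, t)] suffices and no growth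
    estimate of [bayes_loss] in [x] is called for. *)
Lemma bayes_convolution_lty r a b x t : 0 <= t ->
  (\int[mu]_y (bayes_loss r a b (x - y)%R (t + e) *
                (gauss_density (e * D) 0 y)%:E) < +oo)%E.
Proof.
move=> t0; rewrite -bayes_loss_convolution.
apply: (@posterior_moment_lty _ _ _ (r%:R * e)) => //.
- by rewrite mulr_ge0 ?(ltW e0).
- exact: measurable_cond_loss_step.
- move=> w; apply: integral_ge0 => z _.
  by rewrite mule_ge0 ?cond_loss_ge0// lee_fin gauss_density_ge0.
- move=> w; rewrite -mulrA; apply: gauss_step_le.
  + by rewrite mulr_ge0 ?mulr_ge0 ?(ltW e0).
  + exact: measurable_cond_loss_income.
  + by move=> y; exact: cond_loss_ge0.
  + by move=> y; exact: cond_loss_le.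
Qed.

(** Whole-line extended-real forms of [g1] and, next, of [g2]: positive parts replace the
    restriction to a half-interval. *)
Definition posterior_loss1 x t : \bar R :=
  (\int[mu]_w ((Num.max 0 w)%:E * (posterior_weight x t w)%:E))%E.
Definition posterior_loss2 x t : \bar R :=
  (\int[mu]_w ((Num.max 0 (- w))%:E * (posterior_weight x t w)%:E))%E.

(** The action probabilities depend on the history and not on the unknown mean, so they leave the
    integral over [w]. *)
Lemma bayes_lossS r a b x t :
  (bayes_loss r.+1 a b x t =
   (p arm1 a b x)%:E * (e%:E * posterior_loss1 x t + bayes_loss r a.+1 b x t) +
   (p arm2 a b x)%:E * (e%:E * posterior_loss2 x t +
     \int[mu]_y (bayes_loss r a b.+1 (x - y)%R (t + e) *
                 (gauss_density (e * D) 0 y)%:E)))%E.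
Proof.
have mW : measurable_fun setT (fun w => (posterior_weight x t w)%:E).
  by apply/measurable_EFinP; exact: measurable_posterior_weight_mean.
have W0 w : (0 <= (posterior_weight x t w)%:E)%E.
  by rewrite lee_fin posterior_weight_ge0.
have max0 (v : R) : 0 <= Num.max 0 v by rewrite le_max lexx.
have mmax : measurable_fun setT (fun w : R => (Num.max 0 w)%:E).
  by apply/measurable_EFinP; exact: measurable_maxr.
have mmaxN : measurable_fun setT (fun w : R => (Num.max 0 (- w))%:E).
  by apply/measurable_EFinP; exact: measurable_maxr.
have mc := measurable_cond_loss_mean.
have mconv : measurable_fun setT (fun w => \int[mu]_z
    (cond_loss r a b.+1 w (x + z)%R * (gauss_density (e * D) (e * w) z)%:E))%E.
  exact: measurable_cond_loss_step.
have conv0 w : (0 <= \int[mu]_z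
    (cond_loss r a b.+1 w (x + z)%R * (gauss_density (e * D) (e * w) z)%:E))%E.
  by apply: integral_ge0 => z _; rewrite mule_ge0 ?cond_loss_ge0// lee_fin
    gauss_density_ge0.
have lin (k : R) (f g : R -> \bar R) : 0 <= k ->
    measurable_fun setT f -> (forall w, 0 <= f w)%E ->
    measurable_fun setT g -> (forall w, 0 <= g w)%E ->
    (\int[mu]_w (k%:E * f w + g w) = k%:E * \int[mu]_w f w + \int[mu]_w g w)%E.
  move=> k0 mf f0 mg g0; rewrite ge0_integralD//.
  - by rewrite ge0_integralZl// lee_fin.
  - by move=> w _; rewrite mule_ge0// lee_fin.
  - exact: emeasurable_funM.
rewrite {1}/bayes_loss.
transitivity (\int[mu]_w ((p arm1 a b x)%:E *
      (e%:E * ((Num.max 0 w)%:E * (posterior_weight x t w)%:E) +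
        cond_loss r a.+1 b w x * (posterior_weight x t w)%:E) +
    (p arm2 a b x)%:E *
      (e%:E * ((Num.max 0 (- w))%:E * (posterior_weight x t w)%:E) +
        \int[mu]_z (cond_loss r a b.+1 w (x + z)%R *
          (gauss_density (e * D) (e * w) z)%:E) * (posterior_weight x t w)%:E)))%E.
  apply: eq_integral => w _ /=.
  rewrite ge0_muleDl; last 2 first.
  - by rewrite mule_ge0 ?lee_fin// adde_ge0 ?cond_loss_ge0// lee_fin mulr_ge0
      ?(ltW e0).
  - by rewrite mule_ge0 ?lee_fin// adde_ge0// lee_fin mulr_ge0 ?(ltW e0).
  rewrite -!muleA ge0_muleDl ?cond_loss_ge0 ?lee_fin ?mulr_ge0 ?(ltW e0)//.
  by rewrite ge0_muleDl ?lee_fin ?mulr_ge0 ?(ltW e0)// !EFinM !muleA.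
have m1 : measurable_fun setT
    (fun w : R => (Num.max 0 w)%:E * (posterior_weight x t w)%:E)%E.
  exact: emeasurable_funM.
have m2 : measurable_fun setT
    (fun w : R => (Num.max 0 (- w))%:E * (posterior_weight x t w)%:E)%E.
  exact: emeasurable_funM.
have m3 : measurable_fun setT
    (fun w => cond_loss r a.+1 b w x * (posterior_weight x t w)%:E)%E.
  exact: emeasurable_funM.
have m4 := emeasurable_funM mconv mW.
have c3 w : (0 <= cond_loss r a.+1 b w x * (posterior_weight x t w)%:E)%E.
  by rewrite mule_ge0 ?cond_loss_ge0.
have c4 w := mule_ge0 (conv0 w) (W0 w).
have c1 w : (0 <= (Num.max 0 w)%:E * (posterior_weight x t w)%:E)%E.
  by rewrite mule_ge0 ?lee_fin ?posterior_weight_ge0.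
have c2 w : (0 <= (Num.max 0 (- w))%:E * (posterior_weight x t w)%:E)%E.
  by rewrite mule_ge0 ?lee_fin ?posterior_weight_ge0.
have e0' := ltW e0.
have e0E : (0 <= e%:E)%E by rewrite lee_fin.
have pE l : (0 <= (p l a b x)%:E)%E by rewrite lee_fin.
rewrite lin//; last 4 first.
- by apply: emeasurable_funD => //; exact: emeasurable_funM.
- by move=> w; rewrite adde_ge0// mule_ge0.
- apply: emeasurable_funM => //; apply: emeasurable_funD => //.
  exact: emeasurable_funM.
- by move=> w; rewrite mule_ge0// adde_ge0// mule_ge0.
rewrite ge0_integralZl//; last 2 first.
- by apply: emeasurable_funD => //; exact: emeasurable_funM.
- by move=> w _; rewrite adde_ge0// mule_ge0.
rewrite !lin//; congr (_ + _ * (_ + _))%E.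
exact: bayes_loss_convolution.
Qed.

End conditional_loss.

(** * The dynamic programming equation *)

Section batches.
Context {R : realType}.
Variables (N M : nat).
Hypotheses (hN : (0 < N)%N) (hM : (0 < M)%N) (hMN : (M %| N)%N).
Local Notation e := (@eps R N M).

Lemma eps_gt0 : 0 < e.
Proof. by rewrite divr_gt0// ltr0n. Qed.

Lemma batches_eps : (N %/ M)%:R * e = 1 :> R.
Proof.
have N0 : N%:R != 0 :> R by rewrite pnatr_eq0 -lt0n.
by rewrite /eps mulrA -natrM divnK// divff.
Qed.

Lemma batch_sum_lt1 a b : (a%:R * e + b%:R * e < 1) = (a + b < N %/ M)%N.
Proof. by rewrite -mulrDl -natrD -[ltRHS]batches_eps ltr_pM2r ?eps_gt0// ltr_nat. Qed.

Lemma batch_sum_eq1 a b : (a + b)%N = (N %/ M)%N -> a%:R * e + b%:R * e = 1.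
Proof. by move=> ab; rewrite -mulrDl -natrD ab batches_eps. Qed.

Lemma on_grid_batch a b : on_grid N M (a%:R * e) (b%:R * e).
Proof. by exists a, b. Qed.

Lemma scaled_batches a : (a * M)%:R / N%:R = a%:R * e :> R.
Proof. by rewrite natrM /eps mulrA. Qed.

Variable sigma : bool -> R -> R -> R -> R.
Hypothesis hsigma : is_strategy N M sigma.

(* [sigma] at the grid points where a selection is still to be made, completed
   by the arbitrary choice of the first action elsewhere. *)
Definition policy (l : bool) (a b : nat) (x : R) : R :=
  if (a + b < N %/ M)%N then sigma l (a%:R * e) x (b%:R * e)
  else (l == arm1)%:R.

Lemma policyE l a b x : (a + b < N %/ M)%N ->
  policy l a b x = sigma l (a%:R * e) x (b%:R * e).
Proof. by rewrite /policy => ->. Qed.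

Lemma policy_ge0 l a b x : 0 <= policy l a b x.
Proof.
rewrite /policy; case: ifPn => // ab.
by apply: (strategy_ge0 hsigma); [exact: on_grid_batch|rewrite batch_sum_lt1].
Qed.

Lemma policy_sum1 a b x : policy arm1 a b x + policy arm2 a b x = 1.
Proof.
rewrite /policy; case: ifPn => [ab|_]; last by rewrite addr0.
by apply: (strategy_sum1 hsigma); [exact: on_grid_batch|rewrite batch_sum_lt1].
Qed.

Lemma measurable_policy l a b : measurable_fun setT (policy l a b).
Proof.
rewrite /policy; case: (boolP (a + b < N %/ M)%N) => // ab.
by apply: (strategy_measurable hsigma); [exact: on_grid_batch|rewrite batch_sum_lt1].
Qed.

(** * The prior extended to the line, and the running costs [g1] and [g2] *)

Variables (D C : R) (lambda : R -> R).
Hypotheses (hD : 0 < D) (hlambda : is_prior C lambda).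
Local Notation mu := (@lebesgue_measure R).
Local Notation s := (Num.sqrt N%:R : R).
Let c : R := s * C.

Lemma sqrtN_gt0 : 0 < s.
Proof. by rewrite sqrtr_gt0 ltr0n. Qed.

Let s0 := sqrtN_gt0.
Let e0 := eps_gt0.

(** Since [lambda] is controlled only on [[- C, C]], extension by zero makes it measurable and
    nonnegative everywhere. *)
Definition prior : R -> R := lambda \_ `[- C, C]%classic.

Lemma patched_prior_ge0 m : 0 <= prior m.
Proof.
rewrite /prior patchE; case: ifPn => //.
by rewrite inE/= in_itv/= -ler_norml => /(prior_ge0 hlambda).
Qed.

Lemma measurable_prior : measurable_fun setT prior.
Proof.
by apply/(measurable_restrictT _ _).1 => //; exact: prior_measurable hlambda.
Qed.

Lemma integral_prior : (\int[mu]_m (prior m)%:E = 1)%E.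
Proof.
rewrite -(prior_mass1 hlambda) [RHS]integral_mkcond; apply: eq_integral => m _.
by rewrite /prior !patchE; case: ifPn.
Qed.

Definition rho (w : R) : R := s^-1 * prior (s^-1 * w).

Lemma rho_ge0 w : 0 <= rho w.
Proof. by rewrite mulr_ge0 ?patched_prior_ge0 ?invr_ge0 ?ltW. Qed.

Lemma measurable_rho : measurable_fun setT rho.
Proof.
apply: measurable_funM => //; apply: (measurableT_comp measurable_prior).
exact: measurable_funM.
Qed.

Lemma ge0_integral_rho (g : R -> \bar R) : measurable_fun setT g ->
  (forall w, 0 <= g w)%E ->
  (\int[mu]_w (g w * (rho w)%:E) = \int[mu]_m (g (s * m)%R * (prior m)%:E))%E.
Proof.
move=> mg g0.
have mr : measurable_fun setT (fun w => (rho w)%:E).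
  by apply/measurable_EFinP; exact: measurable_rho.
have mp : measurable_fun setT (fun w => (prior w)%:E).
  by apply/measurable_EFinP; exact: measurable_prior.
have mgr : measurable_fun setT (fun w => g w * (rho w)%:E)%E.
  exact: emeasurable_funM.
rewrite (@ge0_integral_affine _ s 0) ?gt_eqF//; last first.
- by move=> w; rewrite mule_ge0// lee_fin rho_ge0.
rewrite gtr0_norm// -ge0_integralZl//; last 2 first.
- by apply: (measurableT_comp mgr); exact: measurable_funD.
- by move=> m _; rewrite mule_ge0// lee_fin rho_ge0.
apply: eq_integral => m _; rewrite addr0 muleCA -EFinM /rho mulrA divff ?gt_eqF//.
by rewrite mul1r mulrA mulVf ?gt_eqF// mul1r.
Qed.

Lemma rho_finite : (\int[mu]_w (rho w)%:E < +oo)%E.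
Proof.
have := @ge0_integral_rho (cst 1%E) (measurable_cst _) (fun=> lee01).
by under eq_integral do rewrite mul1e; move=> ->;
  under eq_integral do rewrite mul1e; rewrite integral_prior ltry.
Qed.

Lemma rhoE w : `|w| <= c -> rho w = scaled_prior N lambda w.
Proof.
move=> wc; rewrite /rho /scaled_prior /prior patchE mem_set//= in_itv/= -ler_norml.
by rewrite normrM gtr0_norm ?invr_gt0// mulrC ler_pdivrMr// mulrC.
Qed.

Lemma rho_support w : c < `|w| -> rho w = 0.
Proof.
move=> cw; rewrite /rho /prior patchE memNset ?mulr0//= in_itv/= -ler_norml.
apply/negP; rewrite -ltNge normrM gtr0_norm ?invr_gt0//.
by rewrite mulrC ltr_pdivlMr// mulrC.
Qed.

Local Notation weight := (posterior_weight D rho).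

Let weightE x t w : `|w| <= c ->
  weight x t w =
  expR (D^-1 * (x * w - 2^-1 * t * w ^+ 2)) * scaled_prior N lambda w.
Proof. by move=> wc; rewrite /posterior_weight rhoE. Qed.

Let moment_fin x t (g : R -> R) : 0 <= t -> measurable_fun setT g ->
  (forall w, 0 <= g w) -> (forall w, g w <= `|w|) ->
  (\int[mu]_w ((g w)%:E * (weight x t w)%:E))%E \is a fin_num.
Proof.
move=> t0 mg g0 gw; rewrite ge0_fin_numE.
  apply: (@posterior_moment_lty R D hD c rho rho_ge0 measurable_rho rho_support
    rho_finite x t (fun w => (g w)%:E) 1) => //.
  - exact/measurable_EFinP.
  - by move=> w; rewrite lee_fin mul1r.
by apply: integral_ge0 => w _; rewrite -EFinM lee_fin mulr_ge0//
  posterior_weight_ge0//; exact: rho_ge0.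
Qed.

(** Off [[0, c]] either the positive part of [w] or [rho] vanishes. Finiteness, which lets [fine] be
    undone, is where [0 <= t] enters. *)
Lemma g1E x t : 0 <= t -> (g1 N D C lambda x t)%:E = posterior_loss1 D rho x t.
Proof.
move=> t0; rewrite /g1 /Rintegral.
suff -> : (\int[mu]_(w in `[0%R, c]) (w *
    expR (D^-1 * (x * w - 2^-1 * t * w ^+ 2)) * scaled_prior N lambda w)%:E =
    posterior_loss1 D rho x t)%E.
  rewrite fineK//; apply: moment_fin => //.
  - exact: measurable_maxr.
  - by move=> w; rewrite le_max lexx.
  - by move=> w; rewrite ge_max normr_ge0 ler_norm.
rewrite integral_mkcond; apply: eq_integral => w _; rewrite patchE.
case: ifPn; rewrite ?inE ?notin_setE/= in_itv/= => wc.
  have /andP[w0 wlec] := wc.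
  rewrite weightE; last by rewrite ger0_norm.
  by rewrite max_r// -EFinM; congr EFin; ring.
have [w0|w0] := leP w 0; first by rewrite mul0e.
have [wlec|cw] := leP w c; first by rewrite (ltW w0) wlec in wc.
by rewrite /posterior_weight rho_support ?mulr0 ?mule0// gtr0_norm.
Qed.

Lemma g2E x t : 0 <= t -> (g2 N D C lambda x t)%:E = posterior_loss2 D rho x t.
Proof.
move=> t0; rewrite /g2 /Rintegral.
suff -> : (\int[mu]_(w in `[(- c)%R, 0%R]) (`|w| *
    expR (D^-1 * (x * w - 2^-1 * t * w ^+ 2)) * scaled_prior N lambda w)%:E =
    posterior_loss2 D rho x t)%E.
  rewrite fineK//; apply: moment_fin => //.
  - exact: measurable_maxr.
  - by move=> w; rewrite le_max lexx.
  - by move=> w; rewrite ge_max normr_ge0 -(normrN w) ler_norm.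
rewrite integral_mkcond; apply: eq_integral => w _; rewrite patchE.
case: ifPn; rewrite ?inE ?notin_setE/= in_itv/= => wc.
  have /andP[cw w0] := wc.
  rewrite weightE; last by rewrite ler0_norm// lerNl.
  rewrite max_r ?oppr_ge0// ler0_norm//.
  by rewrite -EFinM; congr EFin; ring.
have [w0|w0] := leP 0 w; first by rewrite max_l ?oppr_le0// mul0e.
have [cw|wc'] := leP (- c) w; first by rewrite (ltW w0) cw in wc.
by rewrite /posterior_weight rho_support ?mulr0 ?mule0// ltr0_norm// ltrNr.
Qed.

Variables (l l1 l2 : R -> R -> R -> R).
Hypothesis hl : dp_equation N M D C lambda sigma l l1 l2.

(** Induction on the number [r] of batches left, backwards from the boundary [s + t = 1]; batch
    counts in place of grid points make the recursion structural. *)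
Lemma dp_bayes_loss r a b x : (a + b + r)%N = (N %/ M)%N ->
  (l (a%:R * e) x (b%:R * e))%:E =
  bayes_loss e D policy rho r a b x (b%:R * e).
Proof.
elim: r a b x => [|r IH] a b x abr.
  rewrite addn0 in abr; have st1 := batch_sum_eq1 abr.
  rewrite (dp_mix hl) ?st1//; last exact: on_grid_batch.
  (* On the boundary [sigma] is unconstrained, but it multiplies zero. *)
  have [-> ->] := dp_end hl x (on_grid_batch a b) st1.
  rewrite !mulr0 addr0 /bayes_loss integral0_eq// => w _.
  by rewrite /= mul0e.
have ab : (a + b < N %/ M)%N by rewrite -abr addnS ltnS leq_addr.
have st : a%:R * e + b%:R * e < 1 by rewrite batch_sum_lt1.
have grid := on_grid_batch a b.
have be0 : 0 <= b%:R * e by rewrite mulr_ge0 ?(ltW e0).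
have eS n : n%:R * e + e = n.+1%:R * e by rewrite -natr1 mulrDl mul1r.
rewrite (dp_mix hl) ?(ltW st)// (dp_step1 hl)// (dp_step2 hl)// !eS.
rewrite bayes_lossS//; first last.
- exact: measurable_rho.
- exact: rho_ge0.
- exact: measurable_policy.
- exact: policy_ge0.
rewrite !policyE// -g1E// -g2E// -IH ?addSn -?abr ?addnS//.
(* The real convolution agrees with the extended integral because the latter is finite. *)
have convE : (convolution ((l (a%:R * e))^~ (b.+1%:R * e))
    (gauss_density (e * D) 0) x)%:E =
  (\int[mu]_y (bayes_loss e D policy rho r a b.+1 (x - y) (b%:R * e + e) *
       (gauss_density (e * D) 0 y)%:E))%E.
  rewrite /convolution /Rintegral eS.
  under eq_integral => y _.
    rewrite EFinM IH; last by rewrite -abr addnS addSn addnS.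
    over.
  rewrite fineK// ge0_fin_numE; last first.
    apply: integral_ge0 => y _; rewrite mule_ge0 ?lee_fin ?gauss_density_ge0//.
    apply: bayes_loss_ge0; [exact: e0|exact: policy_ge0|exact: rho_ge0].
  rewrite -eS.
  apply: (@bayes_convolution_lty R e D policy e0 hD _ _ _ c) => //.
  - exact: policy_ge0.
  - exact: policy_sum1.
  - exact: measurable_policy.
  - exact: rho_ge0.
  - exact: measurable_rho.
  - exact: rho_support.
  - exact: rho_finite.
by rewrite -convE.
Qed.

End batches.

(** * The process *)

(** The first factor is countable, so a preimage is a countable union of slices. *)
Lemma measurable_nat_prod d1 d2 (T1 : measurableType d1) (T2 : measurableType d2)
    (u : nat -> T1 -> T2) :
  (forall n, measurable_fun setT (u n)) ->
  measurable_fun setT (fun h : nat * T1 => u h.1 h.2).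
Proof.
move=> mu _ B mB; rewrite setTI.
rewrite (_ : _ @^-1` _ = \bigcup_n ([set n] `*` (u n @^-1` B))); last first.
  apply/seteqP; split => [[n x] ux|[n x] [k _ [/= -> ?]]//].
  by exists n.
apply: bigcupT_measurable => n; apply: measurableX => //.
by rewrite -[X in measurable X]setTI; exact: mu.
Qed.

Section history.
Context {R : realType} {d : measure_display} {Omega : measurableType d}.
Variables (N M : nat) (y : nat -> Omega -> bool) (xi : nat -> Omega -> R).
Local Notation s := (Num.sqrt N%:R : R).

(* The income is recorded after [i] steps, possibly in the middle of a batch. *)
Definition history (b i : nat) (w : Omega) : nat * R :=
  ((\sum_(j < b) y (j * M) w)%N, s^-1 * income2 y xi i w).

(** The measurable space is left arbitrary so that the result serves twice: on [Omega] it gives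
    measurability of the history, and on [Omega] with the sigma-algebra of the past it shows that
    history events are past events. *)
Lemma measurable_history_of d' (T : measurableType d')
    (Y : nat -> T -> bool) (Z : nat -> T -> R) b i : (0 < M)%N -> (b * M <= i)%N ->
  (forall j, (j < i)%N -> measurable_fun setT (Y j)) ->
  (forall j, (j < i)%N -> measurable_fun setT (Z j)) ->
  measurable_fun setT (fun w : T =>
    ((\sum_(j < b) Y (j * M) w)%N, s^-1 * \sum_(j < i | Y j w == arm2) Z j w)).
Proof.
move=> M0 bi mY mZ; apply: measurable_fun_pair.
  elim: b bi => [|b IH] bi.
    by under eq_fun do rewrite big_ord0; exact: measurable_cst.
  under eq_fun do rewrite big_ord_recr/=.
  apply: measurable_fun_addn.
    by apply: IH; apply: leq_trans bi; rewrite leq_mul2r leqnSn orbT.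
  rewrite (_ : (fun w => _) = (fun w => if Y (b * M)%N w then 1 else 0)%N); last first.
    by apply/funext => w; case: (Y _ w).
  apply: measurable_fun_ifT => //; apply: mY; apply: leq_trans bi.
  by rewrite mulSn -{1}(add0n (b * M)%N) ltn_add2r.
apply: measurable_funM => //.
under eq_fun do rewrite big_mkcond/=.
apply: measurable_sum => j; apply: measurable_fun_ifT => //; last exact: mZ.
rewrite (_ : (fun w => _) = Y j); first exact: mY.
by apply/funext => w; case: (Y _ w).
Qed.

(** [Omega] with the sigma-algebra of the first [i] actions and incomes, so that belonging to [past]
    becomes measurability. *)
Definition pastType (i : nat) : Type :=
  g_sigma_algebraType (\big[setU/set0]_(k < i)
    preimage_set_system setT (fun w => (y k w, xi k w)) measurable).
HB.instance Definition _ i := Measurable.on (pastType i).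

Lemma past_coordinate i j (B : set (bool * R)) : (j < i)%N -> measurable B ->
  past y xi i ((fun w => (y j w, xi j w)) @^-1` B).
Proof.
move=> ji mB; apply: sub_sigma_algebra.
by rewrite (bigD1 (Ordinal ji))//=; left; exists B => //; rewrite setTI.
Qed.

Lemma past_history b i (B : set (nat * R)) : (0 < M)%N -> (b * M <= i)%N ->
  measurable B -> past y xi i (history b i @^-1` B).
Proof.
move=> M0 bi mB.
have mY j : (j < i)%N -> measurable_fun setT (y j : pastType i -> bool).
  move=> ji _ A mA; rewrite setTI.
  rewrite (_ : _ @^-1` A = (fun w => (y j w, xi j w)) @^-1` (A `*` setT)).
    by apply: past_coordinate => //; exact: measurableX.
  by apply/seteqP; split => w //= [].
have mZ j : (j < i)%N -> measurable_fun setT (xi j : pastType i -> R).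
  move=> ji _ A mA; rewrite setTI.
  rewrite (_ : _ @^-1` A = (fun w => (y j w, xi j w)) @^-1` (setT `*` A)).
    by apply: past_coordinate => //; exact: measurableX.
  by apply/seteqP; split => w //= [].
by have := measurable_history_of M0 bi mY mZ measurableT mB; rewrite setTI.
Qed.

End history.

(** * Laws of the next action and of the income of a batch *)

Section bandit_process.
Context {R : realType} {d : measure_display} {Omega : measurableType d}.
Variables (N M : nat) (D : R).
Hypotheses (hN : (0 < N)%N) (hM : (0 < M)%N) (hMN : (M %| N)%N) (hD : 0 < D).
Variable nu1 : probability (measurableTypeR R) R.
Variable sigma : bool -> R -> R -> R -> R.
Hypothesis hsigma : is_strategy N M sigma.
Variables (y : nat -> Omega -> bool) (xi : nat -> Omega -> R).
Variables (P : probability Omega R) (m : R).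
Hypothesis law : bandit_law N M D nu1 sigma y xi P m.
Local Notation s := (Num.sqrt N%:R : R).
Local Notation e := (@eps R N M).
Local Notation K := (N %/ M)%N.
Local Notation mu := (@lebesgue_measure R).
Local Notation H := (history N M y xi).

Lemma batch_step_lt b j : (b < K)%N -> (j < M)%N -> (b * M + j < N)%N.
Proof.
move=> bK jM; rewrite -(divnK hMN); apply: leq_trans (_ : b.+1 * M <= _)%N.
  by rewrite mulSn addnC ltn_add2r.
by rewrite leq_mul2r bK orbT.
Qed.

Lemma batch_start_lt b : (b < K)%N -> (b * M < N)%N.
Proof. by move=> bK; have := batch_step_lt bK hM; rewrite addn0. Qed.

Lemma batch_action b j w : (b < K)%N -> (j < M)%N -> y (b * M + j) w = y (b * M) w.
Proof.
move=> bK; elim: j => [|j IH] jM; first by rewrite addn0.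
rewrite -(IH (ltnW jM)) (law_batch law) ?batch_step_lt// ?addnS//.
by rewrite -addnS addnC dvdn_addl ?dvdn_mull// gtnNdvd.
Qed.

Lemma applicationsS l i w :
  applications y l i.+1 w = (applications y l i w + (y i w == l))%N.
Proof. by rewrite /applications big_mkcond big_ord_recr -big_mkcond/=; case: eqP. Qed.

Lemma income2S i w :
  income2 y xi i.+1 w = income2 y xi i w + (if y i w == arm2 then xi i w else 0).
Proof. by rewrite /income2 big_mkcond big_ord_recr -big_mkcond. Qed.

Lemma applications_batch l b j w : (b < K)%N -> (j <= M)%N ->
  applications y l (b * M + j) w =
  (applications y l (b * M) w + j * (y (b * M) w == l))%N.
Proof.
move=> bK; elim: j => [|j IH] jM; first by rewrite !addn0.
rewrite addnS applicationsS IH 1?ltnW// batch_action// mulSn -addnA.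
by rewrite [(j * _ + _)%N]addnC.
Qed.

Lemma income2_batch1 b j w : (b < K)%N -> (j <= M)%N -> y (b * M) w = arm1 ->
  income2 y xi (b * M + j) w = income2 y xi (b * M) w.
Proof.
move=> bK jM yw; elim: j jM => [|j IH] jM; first by rewrite addn0.
by rewrite addnS income2S batch_action// yw/= addr0 IH// ltnW.
Qed.

Lemma batches2_le b i w : ((H b i w).1 <= b)%N.
Proof.
rewrite /history /=; elim: b => [|b IH]; first by rewrite big_ord0.
by rewrite big_ord_recr/= -addn1 leq_add// leq_b1.
Qed.

Lemma applications2E b i w : (b <= K)%N ->
  applications y arm2 (b * M) w = ((H b i w).1 * M)%N.
Proof.
elim: b => [|b IH] bK; first by rewrite /applications /history/= !big_ord0.
rewrite mulSn addnC applications_batch// IH 1?ltnW// /history/= big_ord_recr/=.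
by rewrite mulnDl mulnC; case: (y _ w); rewrite /= ?muln1 ?mul1n ?muln0 ?mul0n// mulnC.
Qed.

Lemma applications1E b i w : (b <= K)%N ->
  applications y arm1 (b * M) w = ((b - (H b i w).1) * M)%N.
Proof.
elim: b => [|b IH] bK; first by rewrite /applications !big_ord0.
rewrite mulSn addnC applications_batch// IH 1?ltnW//.
have := batches2_le b i w; rewrite /history/= big_ord_recr/=.
case: (y _ w); rewrite /= ?muln1 ?muln0 ?addn0 ?addn1 ?subSS// => le_b.
by rewrite subSn// mulSn addnC.
Qed.

Lemma measurable_history b i : (b * M <= i)%N -> (i <= N)%N ->
  measurable_fun setT (H b i).
Proof.
move=> bi iN; apply: measurable_history_of => // j ji.
  by apply: (law_action_measurable law); exact: leq_trans iN.
by apply: (law_income_measurable law); exact: leq_trans iN.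
Qed.

Lemma measurable_action i l : (i < N)%N -> measurable (y i @^-1` [set l]).
Proof.
by move=> iN; rewrite -[X in measurable X]setTI; exact: (law_action_measurable law).
Qed.

(** After [b] batches the first action has been used in [b - h.1] of them. The subtraction does not
    truncate on actual histories, where [h.1 <= b]. *)
Definition history_policy l b (h : nat * R) : R :=
  policy N M sigma l (b - h.1) h.1 h.2.

Lemma measurable_history_policy l b : measurable_fun setT (history_policy l b).
Proof.
apply: (@measurable_nat_prod _ _ _ _ (fun n x => policy N M sigma l (b - n) n x)).
by move=> n; exact: measurable_policy.
Qed.

(** Applied to history events, [law_action] says that the law of the history restricted to the
    choice of [l] has density [history_policy] with respect to the full law of the history. *)
Lemma integral_action l b (u : nat * R -> \bar R) : (b < K)%N ->
  measurable_fun setT u -> (forall h, 0 <= u h)%E ->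
  (\int[P]_(w in y (b * M) @^-1` [set l]) u (H b (b * M) w) =
   \int[P]_w (u (H b (b * M) w) * (history_policy l b (H b (b * M) w))%:E))%E.
Proof.
move=> bK mu' u0; have bN := batch_start_lt bK.
have mE := measurable_action l bN.
have mH := measurable_history (leqnn _) (ltnW bN).
have p0 h : 0 <= history_policy l b h by exact: policy_ge0.
have mp := measurable_history_policy l b.
have mHB B : measurable B -> measurable (H b (b * M) @^-1` B).
  by move=> mB; rewrite -[X in measurable X]setTI; exact: mH.
have dens B : measurable B -> pushforward_measure (mrestr P mE) mH B =
    (\int[pushforward_measure P mH]_(h in B) (history_policy l b h)%:E)%E.
  move=> mB; rewrite ge0_integral_pushforward//; last 2 first.
  - by apply/measurable_EFinP; exact: measurable_funTS.
  - by move=> h _; rewrite lee_fin.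
  rewrite /= /pushforward /mrestr (law_action law)//; last 2 first.
  - by rewrite dvdn_mull.
  - exact: past_history.
  apply: eq_integral => w _; congr EFin.
  rewrite (applications1E (b * M) w (ltnW bK)) (applications2E (b * M) w (ltnW bK)).
  rewrite !scaled_batches /= /history_policy policyE//.
  by rewrite subnK// batches2_le.
transitivity (\int[pushforward_measure (mrestr P mE) mH]_h u h)%E.
  rewrite ge0_integral_pushforward//= preimage_setT ge0_integral_mrestr//.
  exact: (measurableT_comp mu' mH).
rewrite (ge0_integral_density mp p0 dens mu' u0) ge0_integral_pushforward//=.
- by apply: emeasurable_funM => //; exact/measurable_EFinP.
- by move=> h _; rewrite mule_ge0// lee_fin.
Qed.

(** The next income is independent of the history given the second action; scaling it by [s^-1]
    gives mean [s^-1 * m] and variance [s^-1 ^+ 2 * D]. The batch count in the history stays frozen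
    during the batch. *)
Lemma integral_income_step b j (u : nat -> R -> \bar R) : (b < K)%N -> (j < M)%N ->
  (forall a, measurable_fun setT (u a)) -> (forall a x, 0 <= u a x)%E ->
  (\int[P]_(w in y (b * M) @^-1` [set arm2])
     u (H b (b * M + j.+1) w).1 (H b (b * M + j.+1) w).2 =
   \int[P]_(w in y (b * M) @^-1` [set arm2]) \int[mu]_z
     (u (H b (b * M + j) w).1 ((H b (b * M + j) w).2 + z)%R *
      (gauss_density (s^-1 ^+ 2 * D) (s^-1 * m) z)%:E))%E.
Proof.
move=> bK jM mu' u0; have bN := batch_start_lt bK.
have iN := batch_step_lt bK jM.
have bi : (b * M <= b * M + j)%N by rewrite leq_addr.
have sV : s^-1 != 0 by rewrite invr_eq0 gt_eqF// sqrtN_gt0.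
pose v (q : nat * R * measurableTypeR R) : \bar R := u q.1.1 (q.1.2 + s^-1 * q.2).
have mv : measurable_fun setT v.
  apply: (measurableT_comp (measurable_nat_prod mu')
    (g := fun q : nat * R * measurableTypeR R => (q.1.1, q.1.2 + s^-1 * q.2))).
  apply: measurable_fun_pair; first exact: measurableT_comp.
  by apply: measurable_funD; [exact: measurableT_comp|exact: measurable_funM].
transitivity (\int[P]_(w in y (b * M) @^-1` [set arm2])
    v (H b (b * M + j) w, xi (b * M + j) w))%E.
  apply: eq_integral => w; rewrite inE/= => yw.
  rewrite /v /= addnS income2S batch_action// yw eqxx -mulrDr.
  by [].
have indep A B : measurable A -> measurable (B : set (measurableTypeR R)) ->
    P (H b (b * M + j) @^-1` A `&` y (b * M) @^-1` [set arm2] `&`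
       xi (b * M + j) @^-1` B) =
    (P (H b (b * M + j) @^-1` A `&` y (b * M) @^-1` [set arm2]) *
     normal_prob m (Num.sqrt D) B)%E.
  move=> mA mB.
  (* [law_income] speaks of the action at the current step, which is the one selected at the start
     of the batch. *)
  have -> : y (b * M) @^-1` [set arm2] = y (b * M + j) @^-1` [set arm2].
    by apply/seteqP; split => w /=; rewrite batch_action.
  have past_A := @past_history R d Omega N M y xi b (b * M + j) A hM bi mA.
  have income := law_income law arm2 iN past_A mB; exact: income.
have mX : measurable_fun setT (xi (b * M + j) : Omega -> measurableTypeR R).
  exact: law_income_measurable law _ iN.
rewrite (integral_independent (Q := normal_prob m (Num.sqrt D))
  (measurable_action arm2 bN) (measurable_history bi (ltnW iN)) mX
  indep mv)//; last first.
  by move=> q; exact: u0.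
apply: eq_integral => w _; move: (H b (b * M + j) w) => h.
have mvh : measurable_fun setT (fun z => v (h, z)).
  by apply: (measurableT_comp mv); exact: measurable_fun_pair.
have vh0 z : (0 <= v (h, z))%E by exact: u0.
rewrite (ge0_integral_normal D m mvh vh0) /v/=.
have mG : measurable_fun setT (fun z => u h.1 (h.2 + z)).
  by apply: (measurableT_comp (mu' _)); exact: measurable_funD.
have := ge0_integral_gauss_affine m 0 sV hD mG (fun=> u0 _ _).
by rewrite addr0 => <-; apply: eq_integral => z _; rewrite addr0.
Qed.

(** The last step is absorbed into [u] by Gaussian averaging, the induction hypothesis treats the
    earlier ones, and convolution adds up means and variances. *)
Lemma integral_income_batch b j (u : nat -> R -> \bar R) : (b < K)%N -> (j < M)%N ->
  (forall a, measurable_fun setT (u a)) -> (forall a x, 0 <= u a x)%E ->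
  (\int[P]_(w in y (b * M) @^-1` [set arm2])
     u (H b (b * M + j.+1) w).1 (H b (b * M + j.+1) w).2 =
   \int[P]_(w in y (b * M) @^-1` [set arm2]) \int[mu]_z
     (u (H b (b * M) w).1 ((H b (b * M) w).2 + z)%R *
      (gauss_density (j.+1%:R * (s^-1 ^+ 2 * D)) (j.+1%:R * (s^-1 * m)) z)%:E))%E.
Proof.
move=> bK; have V0 : 0 < s^-1 ^+ 2 * D.
  by rewrite mulr_gt0// exprn_gt0// invr_gt0 sqrtN_gt0.
have step := fun j u => @integral_income_step b j u bK.
move: V0 step; move: (s^-1 ^+ 2 * D) (s^-1 * m) => V1 m1 V0 step.
elim: j u => [|j IH] u jM mu' u0.
  by rewrite (step 0%N u jM mu' u0) addn0 !mul1r.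
rewrite (step j.+1 u jM mu' u0).
pose u' a x := (\int[mu]_z (u a (x + z)%R *
  (gauss_density V1 m1 z)%:E))%E.
have mu'' a : measurable_fun setT (u' a).
  apply: (measurable_fun_fubini_tonelli_F (m2 := mu) (fun q : R * R =>
    u a (q.1 + q.2)%R * (gauss_density V1 m1 q.2)%:E)%E).
    apply: emeasurable_funM.
      by apply: (measurableT_comp (mu' a)); exact: measurable_funD.
    by apply: (measurableT_comp (emeasurable_gauss_density _ _)).
  by move=> q; rewrite mule_ge0// lee_fin gauss_density_ge0.
have u''0 a x : (0 <= u' a x)%E.
  by apply: integral_ge0 => z _; rewrite mule_ge0// lee_fin gauss_density_ge0.
etransitivity; first exact: (IH u' (ltnW jM) mu'' u''0).
apply: eq_integral => w _; move: (H b (b * M) w) => [a x] /=.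
have mG : measurable_fun setT (fun z => u a (x + z)).
  by apply: (measurableT_comp (mu' _)); exact: measurable_funD.
have := ge0_integral_gauss_convolution (j.+1%:R * m1) m1
  (mulr_gt0 (ltr0Sn R j) V0) V0 mG (fun=> u0 _ _).
rewrite -[in X in _ -> X](natr1 j.+1) !mulrDl !mul1r => <-.
apply: eq_integral => z _; rewrite /u'; congr (_ * _)%E.
by apply: eq_integral => z' _; rewrite addrA.
Qed.

End bandit_process.

(** * Telescoping the conditional loss along the process *)

Section bandit_loss.
Context {R : realType} {d : measure_display} {Omega : measurableType d}.
Variables (N M : nat) (D : R).
Hypotheses (hN : (0 < N)%N) (hM : (0 < M)%N) (hMN : (M %| N)%N) (hD : 0 < D).
Variable nu1 : probability (measurableTypeR R) R.
Variable sigma : bool -> R -> R -> R -> R.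
Hypothesis hsigma : is_strategy N M sigma.
Variables (y : nat -> Omega -> bool) (xi : nat -> Omega -> R).
Variables (P : probability Omega R) (m : R).
Hypothesis law : bandit_law N M D nu1 sigma y xi P m.
Local Notation s := (Num.sqrt N%:R : R).
Local Notation e := (@eps R N M).
Local Notation K := (N %/ M)%N.
Local Notation mu := (@lebesgue_measure R).
Local Notation H := (history N M y xi).
Local Notation E l b := (y (b * M) @^-1` [set l]).
Local Notation cl := (cond_loss e D (policy N M sigma)).

Let e0 : 0 < e := eps_gt0 hN hM.
Let cl_ge0 := cond_loss_ge0 D e0 (policy_ge0 hN hM hMN hsigma).
Let mcl := measurable_cond_loss_income e0 hD (policy_ge0 hN hM hMN hsigma)
  (measurable_policy hN hM hMN hsigma).

Lemma scaled_mean : M%:R * (s^-1 * m) = e * (s * m).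
Proof.
have ss : s * s = N%:R by rewrite -expr2 sqr_sqrtr.
have s0 : s != 0 by rewrite gt_eqF ?sqrtN_gt0.
by rewrite /eps; move: (Num.sqrt N%:R) ss s0 => t <- t0; field.
Qed.

Lemma scaled_variance : M%:R * (s^-1 ^+ 2 * D) = e * D.
Proof.
have ss : s * s = N%:R by rewrite -expr2 sqr_sqrtr.
have s0 : s != 0 by rewrite gt_eqF ?sqrtN_gt0.
by rewrite /eps; move: (Num.sqrt N%:R) ss s0 => t <- t0; field.
Qed.

Lemma integral_actions b (u : Omega -> \bar R) : (b < K)%N ->
  measurable_fun setT u -> (forall w, 0 <= u w)%E ->
  (\int[P]_w u w = \int[P]_(w in E arm1 b) u w + \int[P]_(w in E arm2 b) u w)%E.
Proof.
move=> bK mu' u0; have bN := batch_start_lt hM hMN bK.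
rewrite -ge0_integral_setU//; last 4 first.
- exact: (measurable_action law).
- exact: (measurable_action law).
- exact: measurable_funTS.
- rewrite disj_set2E; apply/eqP; rewrite -subset0 => w /= [-> //].
congr integral; apply/seteqP; split => w //= _.
by case: (y _ w); [right|left].
Qed.

(** The quantity that telescopes: deterministic at [b = 0], zero at [b = K]. *)
Definition expected_remaining_loss b : \bar R :=
  (\int[P]_w cl (K - b) (b - (H b (b * M) w).1) (H b (b * M) w).1 (s * m)
     (H b (b * M) w).2)%E.

Let measurable_remaining r b :
  measurable_fun setT (fun h : nat * R => cl r (b - h.1) h.1 (s * m) h.2).
Proof. by apply: (measurable_nat_prod (u := fun n => cl r (b - n) n (s * m))). Qed.

Lemma expected_remaining_lossS b : (b < K)%N ->
  (expected_remaining_loss b.+1 =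
   \int[P]_(w in E arm1 b) cl (K - b.+1) (b - (H b (b * M) w).1).+1
     (H b (b * M) w).1 (s * m) (H b (b * M) w).2 +
   \int[P]_(w in E arm2 b) \int[mu]_z
     (cl (K - b.+1) (b - (H b (b * M) w).1) (H b (b * M) w).1.+1 (s * m)
       ((H b (b * M) w).2 + z)%R * (gauss_density (e * D) (e * (s * m)) z)%:E))%E.
Proof.
move=> bK; have bM : (b.+1 * M)%N = (b * M + M)%N by rewrite mulSn addnC.
have bMN : (b.+1 * M <= N)%N by rewrite -(divnK hMN) leq_mul2r bK orbT.
rewrite /expected_remaining_loss (integral_actions bK); last 2 first.
- apply: (measurableT_comp (measurable_remaining (K - b.+1) b.+1)).
  exact: (measurable_history hM law).
- by move=> w; exact: cl_ge0.
congr (_ + _)%E.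
  apply: eq_integral => w; rewrite inE => yw.
  have -> : H b.+1 (b.+1 * M) w = H b (b * M) w.
    rewrite /history big_ord_recr/= yw addn0 bM.
    by rewrite (income2_batch1 hMN law bK (leqnn M) yw).
  by rewrite subSn// batches2_le.
pose u a x := cl (K - b.+1) (b - a) a.+1 (s * m) x.
have mu' a : measurable_fun setT (u a) by exact: mcl.
have u0 a x : (0 <= u a x)%E by exact: cl_ge0.
(* The batch lemma covers [j.+1] steps, so a full batch is [j = M.-1]. *)
have M1 : (M.-1 < M)%N by rewrite prednK.
have step := integral_income_batch hN hM hMN hD law bK M1 mu' u0.
rewrite (prednK hM) scaled_mean scaled_variance in step.
etransitivity; last exact: step.
apply: eq_integral => w; rewrite inE => yw.
by rewrite /u/= big_ord_recr/= yw addn1 subSS bM.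
Qed.

(** Unfolding [cond_loss] once gives integrals weighted by the action probabilities;
    [integral_action] turns them into integrals over the action events, whose future parts are those
    of [expected_remaining_lossS]. *)
Lemma bellman b : (b < K)%N ->
  (expected_remaining_loss b =
   (e * Num.max 0 (s * m))%:E * P (E arm1 b) +
   (e * Num.max 0 (- (s * m)))%:E * P (E arm2 b) +
   expected_remaining_loss b.+1)%E.
Proof.
move=> bK; have bN := batch_start_lt hM hMN bK.
have max0 (v : R) : 0 <= Num.max 0 v by rewrite le_max lexx.
have mE l := measurable_action law l bN.
have mH := measurable_history hM law (leqnn _) (ltnW bN).
have pol0 l h : (0 <= (history_policy N M sigma l b h)%:E)%E.
  by rewrite lee_fin; exact: policy_ge0.
have mpol l : measurable_fun setT (fun h => (history_policy N M sigma l b h)%:E).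
  by apply/measurable_EFinP; exact: measurable_history_policy.
pose c1 : \bar R := (e * Num.max 0 (s * m))%:E.
pose c2 : \bar R := (e * Num.max 0 (- (s * m)))%:E.
have c10 : (0 <= c1)%E by rewrite lee_fin mulr_ge0// ltW.
have c20 : (0 <= c2)%E by rewrite lee_fin mulr_ge0// ltW.
pose v1 (h : nat * R) := cl (K - b.+1) (b - h.1).+1 h.1 (s * m) h.2.
pose v2 (h : nat * R) := (\int[mu]_z (cl (K - b.+1) (b - h.1) h.1.+1 (s * m)
  (h.2 + z)%R * (gauss_density (e * D) (e * (s * m)) z)%:E))%E.
have v10 h : (0 <= v1 h)%E by exact: cl_ge0.
have v20 h : (0 <= v2 h)%E.
  by apply: integral_ge0 => z _; rewrite mule_ge0 ?cl_ge0// lee_fin gauss_density_ge0.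
have mv1 : measurable_fun setT v1.
  exact: (measurable_nat_prod (u := fun n x => cl (K - b.+1) (b - n).+1 n (s * m) x)).
have mv2 : measurable_fun setT v2.
  have mn n : measurable_fun setT (fun x : R => (\int[mu]_z
      (cl (K - b.+1) (b - n) n.+1 (s * m) (x + z)%R *
        (gauss_density (e * D) (e * (s * m)) z)%:E))%E).
    have mc := measurable_cond_loss e0 hD (policy_ge0 hN hM hMN hsigma)
      (measurable_policy hN hM hMN hsigma) (K - b.+1) (b - n) n.+1.
    have mg := measurable_gauss_step e0 hD mc (cl_ge0 _ _ _).
    apply: (measurableT_comp mg (g := fun x : R => (s * m, x))).
    exact: measurable_fun_pair.
  exact: (measurable_nat_prod mn).
rewrite expected_remaining_lossS//.
transitivity (\int[P]_w (
    (c1 + v1 (H b (b * M) w)) *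
      (history_policy N M sigma arm1 b (H b (b * M) w))%:E +
    (c2 + v2 (H b (b * M) w)) *
      (history_policy N M sigma arm2 b (H b (b * M) w))%:E))%E.
  apply: eq_integral => w _; rewrite -(subnSK bK).
  by rewrite [LHS]/= [in LHS]muleC [X in (_ + X)%E]muleC.
have act l c v : (0 <= c)%E -> measurable_fun setT v -> (forall h, 0 <= v h)%E ->
    (\int[P]_w ((c + v (H b (b * M) w)) *
       (history_policy N M sigma l b (H b (b * M) w))%:E) =
     c * P (E l b) + \int[P]_(w in E l b) v (H b (b * M) w))%E.
  move=> c0 mv v0.
  rewrite -(integral_action hN hM hMN hsigma law l (u := fun h => c + v h)%E)//.
  - rewrite ge0_integralD//; first by rewrite integral_cst.
    by apply: measurable_funTS; exact: (measurableT_comp mv mH).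
  - by apply: emeasurable_funD.
  - by move=> h; rewrite adde_ge0.
rewrite ge0_integralD//; last 4 first.
- by move=> w _; rewrite mule_ge0// adde_ge0.
- apply: emeasurable_funM; last exact: (measurableT_comp (mpol _) mH).
  by apply: emeasurable_funD => //; exact: (measurableT_comp mv1 mH).
- by move=> w _; rewrite mule_ge0// adde_ge0.
- apply: emeasurable_funM; last exact: (measurableT_comp (mpol _) mH).
  by apply: emeasurable_funD => //; exact: (measurableT_comp mv2 mH).
by rewrite !act// addeACA.
Qed.

(** * Expected incomes and the regret decomposition *)

Definition income_prob (l : bool) : probability (measurableTypeR R) R :=
  if l then (normal_prob m (Num.sqrt D) : probability (measurableTypeR R) R)
  else nu1.

Lemma integral_income l i (f : R -> \bar R) : (i < N)%N ->
  measurable_fun setT f -> (forall x, 0 <= f x)%E ->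
  (\int[P]_(w in y i @^-1` [set l]) f (xi i w) =
   P (y i @^-1` [set l]) * \int[income_prob l]_x f x)%E.
Proof.
move=> iN mf f0.
have mX : measurable_fun setT (xi i : Omega -> measurableTypeR R).
  exact: law_income_measurable law _ iN.
(* A history with zero batches is available at every step, including mid-batch; the integrand
   ignores it. *)
have mH : measurable_fun setT (H 0 i) by exact: (measurable_history hM law _ (ltnW iN)).
have mE := measurable_action law l iN.
have indep A B : measurable A -> measurable (B : set (measurableTypeR R)) ->
    P (H 0 i @^-1` A `&` y i @^-1` [set l] `&` xi i @^-1` B) =
    (P (H 0 i @^-1` A `&` y i @^-1` [set l]) * income_prob l B)%E.
  move=> mA mB.
  have past_A := @past_history R d Omega N M y xi 0 i A hM (leq0n i) mA.
  have := law_income law l iN past_A mB.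
  by rewrite /income_prob /income_law; case: l {mE}.
have mv : measurable_fun setT
    (fun q : nat * R * measurableTypeR R => f q.2).
  exact: (measurableT_comp mf).
rewrite muleC; etransitivity.
  by apply: (integral_independent mE mH mX indep mv) => q; exact: f0.
exact: (integral_cst P mE (\int[income_prob l]_x f x)%E).
Qed.

Hypothesis hnu1 : nu1.-integrable setT (fun x : R => x%:E).
Hypothesis hnu1_mean : (\int[nu1]_x (x : R)%:E = 0)%E.

Lemma income_prob_integrable l : (income_prob l).-integrable setT (fun x : R => x%:E).
Proof. by rewrite /income_prob; case: l => //; exact: normal_integrable. Qed.

Lemma income_prob_mean l : (\int[income_prob l]_x x%:E = (if l then m else 0)%:E)%E.
Proof. by rewrite /income_prob; case: l => //; exact: normal_mean. Qed.

Let prob2 i : R := fine (P (y i @^-1` [set arm2])).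

Lemma prob_action2 i : (i < N)%N -> P (y i @^-1` [set arm2]) = (prob2 i)%:E.
Proof.
move=> iN; rewrite /prob2 fineK// fin_num_measure//.
exact: (measurable_action law).
Qed.

Lemma prob_action1 i : (i < N)%N -> P (y i @^-1` [set arm1]) = (1 - prob2 i)%:E.
Proof.
move=> iN; have -> : y i @^-1` [set arm1] = ~` (y i @^-1` [set arm2]).
  by apply/seteqP; split => w /=; case: (y i w).
by rewrite probability_setC ?prob_action2//; exact: (measurable_action law).
Qed.

Lemma integral_income_split i (f : R -> \bar R) : (i < N)%N ->
  measurable_fun setT f -> (forall x, 0 <= f x)%E ->
  (\int[P]_w f (xi i w) =
   (1 - prob2 i)%:E * \int[income_prob arm1]_x f x +
   (prob2 i)%:E * \int[income_prob arm2]_x f x)%E.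
Proof.
move=> iN mf f0.
have mfx : measurable_fun setT (fun w => f (xi i w)).
  by apply: (measurableT_comp mf); exact: law_income_measurable law _ iN.
rewrite -prob_action1// -prob_action2// -!integral_income//.
rewrite -ge0_integral_setU//; last 4 first.
- exact: (measurable_action law).
- exact: (measurable_action law).
- exact: measurable_funTS.
- rewrite disj_set2E; apply/eqP; rewrite -subset0 => w /= [-> //].
congr integral; apply/seteqP; split => w //= _.
by case: (y i w); [right|left].
Qed.

Lemma income_integrable i : (i < N)%N ->
  P.-integrable setT (fun w => (xi i w)%:E).
Proof.
move=> iN; have mX := law_income_measurable law iN.
have l1 l := integrableP _ _ _ (income_prob_integrable l).
apply/integrableP; split; first exact/measurable_EFinP.
have mabs : measurable_fun setT (fun x : R => `|x%:E|%E).
  by apply: measurableT_comp.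
rewrite (integral_income_split (f := fun x => `|x%:E|%E) iN mabs)//.
have fin l : (\int[income_prob l]_x `|x%:E| \is a fin_num)%E.
  rewrite ge0_fin_numE; last exact: integral_ge0.
  by case: (l1 l).
by rewrite ltey_eq fin_numD !fin_numM.
Qed.

(** The splitting by action holds for nonnegative functions, so it is applied to positive and
    negative parts; their finiteness allows the subtraction, and the zero mean of [nu1] removes the
    first action. *)
Lemma expected_income i : (i < N)%N ->
  (\int[P]_w (xi i w)%:E = (prob2 i * m)%:E)%E.
Proof.
move=> iN; rewrite integralE.
pose f (x : R) := x%:E.
have mf : measurable_fun setT f by exact/measurable_EFinP.
have Ip := integral_income_split iN (measurable_funepos mf) (funepos_ge0 f).
have In := integral_income_split iN (measurable_funeneg mf) (funeneg_ge0 f).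
rewrite (_ : (\int[P]_w (fun w => (xi i w)%:E)^\+ w =
    \int[P]_w f^\+ (xi i w))%E); last first.
  by apply: eq_integral => w _; rewrite !funeposE.
rewrite (_ : (\int[P]_w (fun w => (xi i w)%:E)^\- w =
    \int[P]_w f^\- (xi i w))%E); last first.
  by apply: eq_integral => w _; rewrite !funenegE.
rewrite {}Ip {}In.
have fp l : (\int[income_prob l]_x f^\+ x \is a fin_num)%E.
  exact: integrable_pos_fin_num (income_prob_integrable l).
have fn l : (\int[income_prob l]_x f^\- x \is a fin_num)%E.
  exact: integrable_neg_fin_num (income_prob_integrable l).
have mean l : (\int[income_prob l]_x f^\+ x - \int[income_prob l]_x f^\- x =
    (if l then m else 0)%:E)%E.
  by rewrite -income_prob_mean [RHS]integralE.
move: (fp arm1) (fn arm1) (mean arm1) (fp arm2) (fn arm2) (mean arm2).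
rewrite /arm1 /arm2.
case: (\int[income_prob false]_x f^\+ x)%E => // p1 _.
case: (\int[income_prob false]_x f^\- x)%E => // n1 _ [] d1.
case: (\int[income_prob true]_x f^\+ x)%E => // p2 _.
case: (\int[income_prob true]_x f^\- x)%E => // n2 _ [] d2.
have -> : p1 = n1 by apply/subr0_eq.
rewrite -d2; congr EFin; ring.
Qed.

Lemma expected_total_income :
  ('E_P[total_income N xi] = (\sum_(i < N) prob2 i * m)%:E)%E.
Proof.
rewrite unlock /total_income.
under eq_integral do rewrite -sumEFin.
rewrite integral_sum//; last by move=> i; exact: income_integrable.
by rewrite -sumEFin; apply: eq_bigr => i _; rewrite expected_income.
Qed.

Lemma sum_prob2 b : (b <= K)%N ->
  \sum_(i < b * M) prob2 i = M%:R * \sum_(j < b) prob2 (j * M).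
Proof.
elim: b => [|b IH] bK; first by rewrite !big_ord0 mulr0.
rewrite mulSn addnC big_split_ord/= IH ?(ltnW bK)// big_ord_recr/= mulrDr.
congr (_ + _); under eq_bigr => j _.
  rewrite (_ : prob2 (b * M + j) = prob2 (b * M)); first over.
  congr (fine (P _)); apply/seteqP; split => w /=;
    by rewrite (batch_action hMN law w bK (ltn_ord j)).
by rewrite sumr_const card_ord mulr_natl.
Qed.

Lemma cond_loss_telescope b : (b <= K)%N ->
  expected_remaining_loss 0 =
  ((\sum_(j < b) e * (Num.max 0 (s * m) * (1 - prob2 (j * M)) +
     Num.max 0 (- (s * m)) * prob2 (j * M)))%:E + expected_remaining_loss b)%E.
Proof.
elim: b => [|b IH] bK; first by rewrite big_ord0 add0e.
have bN := batch_start_lt hM hMN bK.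
rewrite IH ?(ltnW bK)// bellman// prob_action1// prob_action2// addeA.
congr (_ + _)%E; rewrite big_ord_recr/= [RHS]EFinD; congr (_ + _)%E.
by rewrite -!EFinM -EFinD; congr EFin; ring.
Qed.

(** Writing [m] as [max 0 m - max 0 (- m)] turns the shortfall of income into batch regrets. The
    scaling matches because [s * s * e = M]. *)
Lemma loss_cond_loss :
  (loss N xi P m = s%:E * cl K 0 0 (s * m) 0)%E.
Proof.
have clE : expected_remaining_loss 0 = cl K 0 0 (s * m) 0.
  rewrite /expected_remaining_loss.
  rewrite -[RHS]mule1 -(@probability_setT _ _ _ P) -integral_cst//.
  apply: eq_integral => w _.
  by rewrite /history/= /income2 !big_ord0 mulr0 subn0.
have := cond_loss_telescope (leqnn K); rewrite clE => ->.
have -> : expected_remaining_loss K = 0%E.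
  by rewrite /expected_remaining_loss subnn integral0_eq.
rewrite adde0 /loss expected_total_income -EFinM -EFinB; congr EFin.
rewrite -mulr_suml.
have -> : \sum_(i < N) prob2 i = M%:R * \sum_(j < K) prob2 (j * M).
  by rewrite -sum_prob2// divnK.
have s0 : 0 < s by exact: sqrtN_gt0.
have ss : s * s = N%:R by rewrite -expr2 sqr_sqrtr.
have mxs (v : R) : Num.max 0 (s * v) = s * Num.max 0 v.
  by rewrite maxr_pMr ?(ltW s0)// mulr0.
have mE : m = Num.max 0 m - Num.max 0 (- m).
  by case: (leP 0 m) => m0; [rewrite max_l|rewrite max_r];
    rewrite ?subr0 ?sub0r ?opprK ?oppr_le0 ?oppr_ge0// ltW.
have Ne : N%:R * e = M%:R.
  by rewrite /eps mulrCA divff ?mulr1// pnatr_eq0 -lt0n.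
have NK : N%:R = K%:R * M%:R :> R by rewrite -natrM divnK.
have -> : \sum_(j < K) e * (Num.max 0 (s * m) * (1 - prob2 (j * M)) +
      Num.max 0 (- (s * m)) * prob2 (j * M)) =
    s * e * (K%:R * Num.max 0 m +
      (Num.max 0 (- m) - Num.max 0 m) * \sum_(j < K) prob2 (j * M)).
  transitivity (\sum_(j < K) (s * e * Num.max 0 m +
      s * e * (Num.max 0 (- m) - Num.max 0 m) * prob2 (j * M))).
    by apply: eq_bigr => j _; rewrite -mulrN !mxs; ring.
  by rewrite big_split/= sumr_const card_ord -mulr_natl -mulr_sumr; ring.
rewrite mulrA mulrA ss Ne {1}NK [in X in _ - X]mE; ring.
Qed.

End bandit_loss.

Theorem theorem3p2 (R : realType) (N M : nat) (D C : R)
    (hN : (0 < N)%N) (hM : (0 < M)%N) (hMN : (M %| N)%N)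
    (hD : 0 < D) (hC : 0 < C)
    (nu1 : probability (measurableTypeR R) R)
    (hnu1 : nu1.-integrable setT (fun x : R => x%:E))
    (hnu1_mean : (\int[nu1]_x (x : R)%:E = 0)%E)
    (lambda : R -> R) (hlambda : is_prior C lambda)
    (sigma : bool -> R -> R -> R -> R) (hsigma : is_strategy N M sigma)
    (d : measure_display) (Omega : measurableType d)
    (y : nat -> Omega -> bool) (xi : nat -> Omega -> R)
    (P : R -> probability Omega R)
    (hP : forall m : R, `|m| <= C -> bandit_law N M D nu1 sigma y xi (P m) m)
    (l l1 l2 : R -> R -> R -> R)
    (hl : dp_equation N M D C lambda sigma l l1 l2) :
  mean_loss N xi C lambda P = (Num.sqrt N%:R * l 0 0 0)%:E.
Proof.
set s : R := Num.sqrt N%:R.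
pose V w := cond_loss (@eps R N M) D (policy N M sigma) (N %/ M)%N 0 0 w 0.
have s0 : 0 < s by exact: sqrtN_gt0.
have e0 := @eps_gt0 R _ _ hN hM.
have p0 := policy_ge0 hN hM hMN hsigma.
have mV : measurable_fun setT V.
  exact: (measurable_cond_loss_mean e0 hD p0 (measurable_policy hN hM hMN hsigma)).
have V0 w : (0 <= V w)%E by exact: cond_loss_ge0.
have msV : measurable_fun setT (fun m => V (s * m)).
  by apply: (measurableT_comp mV); exact: measurable_funM.
have mprior : measurable_fun setT (fun m => (prior C lambda m)%:E).
  by apply/measurable_EFinP; exact: measurable_prior.
(* Off [[- C, C]] both integrands vanish; inside, [hP] supplies the law under which the loss has its
   closed form. *)
transitivity (\int[lebesgue_measure]_m
    (s%:E * (V (s * m)%R * (prior C lambda m)%:E)))%E.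
  rewrite /mean_loss integral_mkcond; apply: eq_integral => m _.
  rewrite patchE /prior [in RHS]patchE; case: ifPn => [|_]; last by rewrite !mule0.
  rewrite inE/= in_itv/= -ler_norml => mC.
  by rewrite (loss_cond_loss hN hM hMN hD hsigma (hP m mC) hnu1 hnu1_mean) muleA.
rewrite ge0_integralZl//; last 3 first.
- exact: emeasurable_funM.
- by move=> m _; rewrite mule_ge0// lee_fin; exact: patched_prior_ge0.
- by rewrite lee_fin ltW.
rewrite -ge0_integral_rho// EFinM; congr (_ * _)%E.
have K0 : (0 + 0 + N %/ M)%N = (N %/ M)%N by [].
have := dp_bayes_loss hN hM hMN hsigma hD hlambda hl 0 K0.
rewrite !mul0r => ->; apply: eq_integral => w _; congr (_ * _%:E)%E.
by rewrite /posterior_weight mulr0 !mul0r subrr mulr0 expR0 mul1r.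
Qed.
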